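(* Let $H$ be a separable complex Hilbert space and let $T\in\mathcal{L}(H)$ be a $C_0$-contraction which is essentially normal and such that $\sigma(T)\cap\mathbb{T}$ is of Lebesgue measure zero. Assume that for every $f\in\mathcal{A}(\mathbb{D})$ vanishing on $\sigma(T)\cap\mathbb{T}$, the operator $f(T)$ is compact. Then $T$ is essentially unitary.
   Context: $\mathbb{D}$ is the open unit disk, $\mathbb{T}$ the unit circle, $\mathcal{L}(H)$ the bounded operators on $H$, $\sigma(T)$ the spectrum of $T$. $H^\infty$ is the set of bounded holomorphic functions on $\mathbb{D}$. The disk algebra $\mathcal{A}(\mathbb{D})$ is the space of functions holomorphic in $\mathbb{D}$ and continuous on $\overline{\mathbb{D}}$. A contraction is an operator of norm at most $1$; it is completely nonunitary if it has no nonzero reducing subspace on which it acts as a unitary operator. A contraction $T$ on $H$ is a $C_0$-contraction if it is completely nonunitary and there is a nonzero $\theta\in H^\infty$ with $\theta(T)=0$, where $\theta(T)$ is defined by the Sz.-Nagy--Foias $H^\infty$ functional calculus. For $f\in\mathcal{A}(\mathbb{D})$, $f(T)$ is equivalently the operator-norm limit of $p_n(T)$ for any polynomials $p_n\to f$ uniformly on $\overline{\mathbb{D}}$. An operator $T$ is essentially normal if $TT^*-T^*T$ is compact. A contraction $T$ is essentially unitary if $I_H-T^*T$ is compact, where $I_H$ is the identity on $H$. *)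

(* Defs.v *)
From HB Require Import structures.
From mathcomp Require Import all_boot all_order all_algebra.
From mathcomp Require Import sesquilinear complex.
From mathcomp Require Import all_classical all_reals all_analysis.

Set Implicit Arguments.
Unset Strict Implicit.
Unset Printing Implicit Defensive.

Import Order.TTheory GRing.Theory Num.Theory.
Import numFieldNormedType.Exports.

Local Open Scope classical_set_scope.
Local Open Scope complex_scope.
Local Open Scope ring_scope.

Section ComplexFunctions.
Variable R : realType.
(* [R[i]^o] is [R[i]] seen as a normed space over itself; its norm takes
   (nonnegative real) values in [R[i]], where [z < w] requires [w - z] real. *)
Local Notation C := (R[i]^o).
Implicit Types (f : C -> C) (E : set C).

Definition unit_disk : set C := [set z | `|z| < 1].
Definition closed_unit_disk : set C := [set z | `|z| <= 1].
Definition unit_circle : set C := [set z | `|z| = 1].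

Definition holomorphic_on_disk f : Prop :=
  forall z, unit_disk z -> derivable f z 1.

Definition Hinfty f : Prop :=
  holomorphic_on_disk f /\
  exists M : R[i], forall z, unit_disk z -> `|f z| <= M.

Definition disk_algebra f : Prop :=
  holomorphic_on_disk f /\ {within closed_unit_disk, continuous f}.

Definition taylor_coef f (k : nat) : R[i] := derive1n k f 0 / k`!%:R.

Definition circle_null E : Prop :=
  (@lebesgue_measure R).-negligible
    [set t | 0 <= t < 2 * pi /\ E (cos t +i* sin t)].

End ComplexFunctions.

Section Operators.
Variables (R : realType) (H : completeNormedModType R[i]).
Local Notation C := (R[i]^o).
Implicit Types (T : {linear H -> H}) (F : H -> H).

Definition separable_space : Prop :=
  exists2 D : set H, countable D & dense D.

(* With linearity this says that the operator norm is at most 1; it contains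
   the boundedness of [T]. *)
Definition contraction T : Prop := forall x, `|T x| <= `|x|.

Definition compact_op F : Prop := precompact (F @` [set x | `|x| <= 1]).

Definition spectrum T : set C :=
  [set z | ~ exists S : {linear H -> H},
     [/\ continuous S,
         forall x, S (T x - z *: x) = x &
         forall x, T (S x) - z *: S x = x]].

Definition poly_op T (p : {poly R[i]}) (x : H) : H :=
  \sum_(k < size p) p`_k *: iter k T x.

(* [F = f(T)]: [F] is the operator-norm limit of [p_n(T)] for polynomials
   [p_n] converging to [f] uniformly on the closed disk. *)
Definition disk_calculus T (f : C -> C) F : Prop :=
  exists p : nat -> {poly R[i]},
    (forall e : R[i], 0 < e ->
       \forall n \near \oo, forall z, closed_unit_disk z ->
         `|(p n).[z] - f z| <= e) /\
    (forall e : R[i], 0 < e ->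
       \forall n \near \oo, forall x, `|poly_op T (p n) x - F x| <= e * `|x|).

(* [F = theta(T)] in the sense of Sz.-Nagy and Foias: with [c_k] the Taylor
   coefficients of [theta], [F] is the strong limit, as r increases to 1, of
   [theta_r(T) = \sum_k c_k r^k T^k]. For a contraction [T] and [theta] in
   [Hinfty] this series converges absolutely when [0 <= r < 1]. *)
Definition Hinfty_calculus T (theta : C -> C) F : Prop :=
  forall x : H,
    limn (series (fun k => (taylor_coef theta k * r%:C ^+ k) *: iter k T x))
      @[r --> (1 : R)^'-] --> F x.

Variable dot : {dot H for @Num.conj R[i]}.

Definition hilbert_norm : Prop := forall x : H, `|x| ^+ 2 = dot x x.

(* In a Hilbert space the vector [z] exists and is unique (Riesz). *)
Definition adjoint T (y : H) : H :=
  get [set z | forall x, dot (T x) y = dot x z].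

Definition closed_subspace (M : set H) : Prop :=
  [/\ closed M, M 0 &
      forall (a : R[i]) (x y : H), M x -> M y -> M (a *: x + y)].

Definition reducing T (M : set H) : Prop :=
  [/\ closed_subspace M,
      forall x, M x -> M (T x) &
      forall x, M x -> M (adjoint T x)].

Definition unitary_on T (M : set H) : Prop :=
  forall x, M x -> adjoint T (T x) = x /\ T (adjoint T x) = x.

Definition completely_nonunitary T : Prop :=
  forall M : set H, reducing T M -> unitary_on T M -> M = [set 0].

Definition C0_contraction T : Prop :=
  [/\ contraction T,
      completely_nonunitary T &
      exists theta : C -> C,
        [/\ Hinfty theta,
            exists2 z, unit_disk z & theta z != 0 &
            Hinfty_calculus T theta (fun=> 0)]].

Definition essentially_normal T : Prop :=
  compact_op (fun x => T (adjoint T x) - adjoint T (T x)).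

Definition essentially_unitary T : Prop :=
  contraction T /\ compact_op (fun x => x - adjoint T (T x)).

End Operators.

(* Main.v *)
(* Let E be the set of unimodular points of the spectrum of the contraction T:
   a null compact set. By a weak form of Fatou's theorem there is, for each
   e > 0, a function f in the disk algebra vanishing on E with |1 - f| <= 1 + e
   on the disk and |1 - f(0)| <= e. Writing 1 - f = c + z u, with |c| and
   |u| - 1 of order e, von Neumann's inequality gives
   |x| <= |f(T) x| + |T x| + O(e) |x|. As |(1 - T^* T) x|^2 <= |x|^2 - |T x|^2
   and f(T) is compact, 1 - T^* T maps the unit ball to a totally bounded
   set. *)
Require Import Defs.
From HB Require Import structures.
From mathcomp Require Import all_boot all_order all_algebra.
From mathcomp Require Import cyclic separable cyclotomic.
From mathcomp Require Import sesquilinear complex.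
From mathcomp Require Import all_classical all_reals all_analysis.
From mathcomp Require Import measurable_realfun.
From mathcomp Require Import ring lra.
Set Implicit Arguments.
Unset Strict Implicit.
Unset Printing Implicit Defensive.

Import Order.TTheory GRing.Theory Num.Theory.
Import numFieldNormedType.Exports.
Local Open Scope classical_set_scope.
Local Open Scope complex_scope.
Local Open Scope ring_scope.

(** The work takes place in the uniform closure of the polynomials on the closed disk. Von Neumann's
    inequality lets [f(T)] be constructed and estimated from polynomials alone. Membership in the
    disk algebra is checked only at the end, where the compactness hypothesis asks for it; the
    maximum principle behind that check is again von Neumann's inequality, for scalar multiples of
    the identity.

    The function [1 - f] must equal 1 on E, nearly vanish at 0, and still have modulus barely above
    1. Taking [f = 1 / (1 + h)] with [Re h >= 0] gives [|1 - f| <= 1] at once. If [h] is large on E,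
    then [f] is small there, and [h(0)] can be kept small because E is covered by arcs of small
    total length. One such [h] makes [f] small on E but not zero, and the compactness hypothesis
    needs exact vanishing; hence a limit of such functions. The value at 0 matters because it makes
    [1 - f] almost divisible by z: the factor [T] then comes out with a coefficient close to 1,
    which is what makes [|x| - |T x|] small up to a compact term. *)

(** * Roots of unity and averaging over them *)

Section PrimitiveRoots.
Variable C : numClosedFieldType.

Lemma primitive_root_exists n : (0 < n)%N -> exists z : C, n.-primitive_root z.
Proof.
move=> n_gt0; pose p : {poly C} := 'X^n - 1.
have [r Dp] := closed_field_poly_normal p.
move: Dp; rewrite lead_coefDl ?lead_coefXn ?size_polyXn ?size_polyN ?size_poly1 //.
rewrite scale1r => Dp.
have rn1 : all n.-unity_root r.
  by apply/allP=> z; rewrite -root_prod_XsubC -Dp.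
have sz_r : (n < (size r).+1)%N.
  by rewrite -(size_prod_XsubC r id) -Dp size_XnsubC.
have [|z] := hasP (has_prim_root n_gt0 rn1 _ sz_r); last by exists z.
rewrite -separable_prod_XsubC -Dp separable_Xn_sub_1 //.
by rewrite pnatr_eq0 -lt0n.
Qed.

(** Orthogonality of characters on the group of roots of unity, the finite substitute for
    integrating over the circle. Exponents below [n] are distinct modulo [n], so for [a != b] the
    ratio [u] is not 1 and its geometric sum vanishes. *)
Lemma sum_primitive_root n (z : C) a b : n.-primitive_root z ->
  (a < n)%N -> (b < n)%N ->
  \sum_(s < n) (z ^+ s) ^+ a * ((z ^+ s)^-1) ^+ b = n%:R *+ (a == b).
Proof.
move=> zn an bn.
have z0 : z != 0.
  apply: contraTneq isT => z0; have := prim_expr_order zn; rewrite z0 expr0n.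
  by rewrite -[n == 0]negbK -lt0n (prim_order_gt0 zn) => /eqP; rewrite eq_sym oner_eq0.
pose u := z ^+ a / z ^+ b.
rewrite (eq_bigr (fun s : 'I_n => u ^+ s)); last first.
  by move=> s _; rewrite /u exprMn !exprVn -!exprM (mulnC a) (mulnC b).
have [ab|ab] := eqVneq a b.
  rewrite (eq_bigr (fun=> 1)) ?sumr_const ?card_ord //.
  by move=> s _; rewrite /u ab divff ?expf_neq0// expr1n.
have u1 : u != 1.
  rewrite /u -subr_eq0 -(can_eq (mulfK (expf_neq0 b z0))) mulrBl mul0r mul1r divfK ?expf_neq0//.
  by rewrite subr_eq0 (eq_prim_root_expr zn) !modn_small.
have: u ^+ n - 1 = 0.
  by rewrite /u exprMn exprVn -!exprM -!(mulnC n) !exprM (prim_expr_order zn) !expr1n divr1 subrr.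
by rewrite subrX1 => /eqP; rewrite mulf_eq0 subr_eq0 (negbTE u1) => /eqP ->.
Qed.

Lemma normC_primitive_root n (z : C) : n.-primitive_root z -> `|z| = 1.
Proof.
move=> zn; have n0 := prim_order_gt0 zn.
apply/eqP; rewrite -(@pexpr_eq1 _ _ n) // -normrX (prim_expr_order zn) normr1//.
Qed.

(** Taking for [c] the phase of [b] makes both cross terms equal to [|b|]. This is the polarization
    step for any positive semidefinite form, with [a] and [d] its diagonal values. *)
Lemma norm_le_half_unimodular (a b d : C) :
  (forall c, `|c| = 1 -> 0 <= a - c^* * b - c * b^* + d) ->
  `|b| <= (a + d) / 2.
Proof.
move=> h; have [b0|b0] := eqVneq b 0.
  have := h 1 (normr1 _); rewrite b0 (rmorph0 Num.conj) normr0 !mulr0 !subr0.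
  by move=> ?; rewrite divr_ge0.
have nb0 : `|b| != 0 by rewrite normr_eq0.
have := h (b / `|b|); rewrite normrM normfV normr_id divff// => /(_ erefl).
rewrite rmorphM fmorphV /= (CrealP (normr_real b)).
have -> : b^* / `|b| * b = `|b|.
  by rewrite mulrAC -[b^* * b]mulrC -normCK expr2 mulfK.
have -> : b / `|b| * b^* = `|b|.
  by rewrite mulrAC -normCK expr2 mulfK.
move=> h0; rewrite ler_pdivlMr ?ltr0n// -subr_ge0.
by rewrite (_ : a + d - _ = a - `|b| - `|b| + d)//; ring.
Qed.

End PrimitiveRoots.

(** * Von Neumann's inequality by a discrete Fejer kernel *)

Section VonNeumann.
Variables (R : realType) (H : completeNormedModType R[i]).
Local Notation C := R[i].
Variable dot : {dot H for @Num.conj C}.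
Hypothesis dotE : hilbert_norm dot.
Variable T : {linear H -> H}.
Hypothesis T1 : Defs.contraction T.

Lemma dotC (x y : H) : dot y x = (dot x y)^*%R.
Proof. by rewrite hermC expr0 mul1r. Qed.

Lemma dotDl x y z : dot (x + y) z = dot x z + dot y z.
Proof. exact: linearDl. Qed.

Lemma dotDr x y z : dot x (y + z) = dot x y + dot x z.
Proof. exact: linearDr. Qed.

Lemma dotBl x y z : dot (x - y) z = dot x z - dot y z.
Proof. exact: linearBl. Qed.

Lemma dotBr x y z : dot x (y - z) = dot x y - dot x z.
Proof. exact: linearBr. Qed.

Lemma dotZl (c : C) x y : dot (c *: x) y = c * dot x y.
Proof. exact: linearZl_LR. Qed.

Lemma dotZr (c : C) x y : dot x (c *: y) = c^*%R * dot x y.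
Proof. exact: linearZr_LR. Qed.

Lemma dot_suml I r (P : pred I) (F : I -> H) y :
  dot (\sum_(i <- r | P i) F i) y = \sum_(i <- r | P i) dot (F i) y.
Proof. exact: linear_sumlz. Qed.

Lemma dot_sumr I r (P : pred I) (F : I -> H) y :
  dot y (\sum_(i <- r | P i) F i) = \sum_(i <- r | P i) dot y (F i).
Proof. exact: linear_sumr. Qed.

Lemma dot_conj_expand (c : C) (x y : H) :
  dot (x - c *: y) (x - c *: y) =
    dot x x - c^*%R * dot x y - c * (dot x y)^*%R + `|c| ^+ 2 * dot y y.
Proof.
rewrite !(dotBl, dotBr, dotZl, dotZr) (dotC x y) normCK; ring.
Qed.

Lemma iter_linear k a x y : iter k T (a *: x + y) = a *: iter k T x + iter k T y.
Proof. by elim: k => //= k ->; rewrite linearP. Qed.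

(** A partial sum of the Neumann series of [(1 - w^-1 T)^-1 x]. For [|w| = 1], pairing two such
    vectors produces the powers [w^(j - i)]. *)
Definition fejer_vec (w : C) (a : nat) (x : H) :=
  \sum_(i < a) (w^-1) ^+ i *: iter i T x.

(* This is [\sum_(i, j <= n) w^(j - i) <T^(i - j) x, y>], with the adjoint of
   [T^(j - i)] in place of [T^(i - j)] when [i < j], written so that its
   positivity is visible. *)
Definition fejer_form w n x y :=
  dot (fejer_vec w n.+1 x) (fejer_vec w n.+1 y) +
  \sum_(a < n) (dot (fejer_vec w a.+1 x) (fejer_vec w a.+1 y) -
    dot (T (fejer_vec w a.+1 x)) (T (fejer_vec w a.+1 y))).

Lemma dot_le_half x y : `|dot x y| <= (dot x x + dot y y) / 2.
Proof.
apply: norm_le_half_unimodular => c c1.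
by have := dnorm_ge0 dot (x - c *: y); rewrite dot_conj_expand c1 expr1n mul1r.
Qed.

Lemma defect_ge0 x : 0 <= dot x x - dot (T x) (T x).
Proof. by rewrite -!dotE subr_ge0 lerXn2r ?nnegrE. Qed.

Lemma defect_le_half x y : `|dot x y - dot (T x) (T y)| <=
  (dot x x - dot (T x) (T x) + (dot y y - dot (T y) (T y))) / 2.
Proof.
apply: norm_le_half_unimodular => c c1.
have := defect_ge0 (x - c *: y); rewrite (linearB T) (linearZ_LR T)/=.  rewrite !dot_conj_expand.
rewrite c1 expr1n !mul1r rmorphB; congr (0 <= _); ring.
Qed.

(** The form is a sum of positive semidefinite forms, the inner product and the defect
    [<x, y> - <T x, T y>], each taken at Fejer vectors; the polarization bound holds for each and
    adds up. *)
Lemma fejer_form_le_half w n x y :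
  `|fejer_form w n x y| <= (fejer_form w n x x + fejer_form w n y y) / 2.
Proof.
have -> : (fejer_form w n x x + fejer_form w n y y) / 2 =
  (dot (fejer_vec w n.+1 x) (fejer_vec w n.+1 x) +
   dot (fejer_vec w n.+1 y) (fejer_vec w n.+1 y)) / 2 +
  \sum_(a < n) (dot (fejer_vec w a.+1 x) (fejer_vec w a.+1 x) -
    dot (T (fejer_vec w a.+1 x)) (T (fejer_vec w a.+1 x)) +
   (dot (fejer_vec w a.+1 y) (fejer_vec w a.+1 y) -
    dot (T (fejer_vec w a.+1 y)) (T (fejer_vec w a.+1 y)))) / 2.
  rewrite /fejer_form -mulr_suml [in RHS]big_split/=; ring.
apply: le_trans (ler_normD _ _) _; apply: lerD; first exact: dot_le_half.
apply: le_trans (ler_norm_sum _ _ _) _; apply: ler_sum => a _.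
exact: defect_le_half.
Qed.

Lemma iter_sum k I r (P : pred I) (F : I -> H) :
  iter k T (\sum_(i <- r | P i) F i) = \sum_(i <- r | P i) iter k T (F i).
Proof. by elim: k => //= k ->; rewrite linear_sum. Qed.

Lemma iterZ k a x : iter k T (a *: x) = a *: iter k T x.
Proof. by elim: k => //= k ->; rewrite linearZ. Qed.

Lemma conj_unimodular (w : C) : `|w| = 1 -> w^*%R = w^-1.
Proof. by move=> w1; rewrite invC_norm w1 expr1n invr1 mul1r. Qed.

(** Orthogonality keeps only the pairs with [i = j + k]. The condition [a + k <= N] holds all
    exponents below [N], so that no other pair is aliased onto these. *)
Lemma sum_fejer_vec N (z : C) a k m x y : N.-primitive_root z ->
  (a + k <= N)%N -> (0 < N)%N ->
  \sum_(s < N) (z ^+ s) ^+ k *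
     dot (iter m T (fejer_vec (z ^+ s) a x)) (iter m T (fejer_vec (z ^+ s) a y)) =
  N%:R * \sum_(j < a - k) dot (iter (m + (j + k)) T x) (iter (m + j) T y).
Proof.
move=> zN akN N0.
pose G i j := dot (iter (m + i) T x) (iter (m + j) T y).
rewrite (eq_bigr (fun s : 'I_N => \sum_(i < a) \sum_(j < a)
    (z ^+ s) ^+ (k + j) * ((z ^+ s)^-1) ^+ i * G i j)); last first.
  move=> s _; have w1 : `|z ^+ s| = 1 by rewrite normrX (normC_primitive_root zN) expr1n.
  rewrite /fejer_vec !iter_sum dot_suml mulr_sumr; apply: eq_bigr => i _.
  rewrite dot_sumr mulr_sumr; apply: eq_bigr => j _.
  rewrite !iterZ dotZl dotZr -!iterD rmorphXn fmorphV /= (conj_unimodular w1) invrK /G exprD.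
  ring.
rewrite exchange_big /=.
rewrite (eq_bigr (fun i : 'I_a => \sum_(j < a) (N%:R *+ (k + j == i)%N) * G i j)); last first.
  move=> i _; rewrite exchange_big /=; apply: eq_bigr => j _.
  rewrite -mulr_suml (sum_primitive_root zN) //.
    by rewrite (leq_trans _ akN)// addnC ltn_add2r.
  by rewrite (leq_trans (ltn_ord i))// (leq_trans _ akN)// leq_addr.
rewrite exchange_big /= mulr_sumr.
rewrite (big_ord_widen_cond a xpredT (fun j => N%:R * G (j + k)%N j)) ?leq_subr //=.
rewrite [RHS]big_mkcond /=; apply: eq_bigr => j _; rewrite ltn_subRL.
case: ifP => jk.
  rewrite (bigD1 (Ordinal jk)) //= eqxx mulr1n big1 ?addr0 1?addnC// => i ik.
  rewrite (_ : (k + j == i)%N = false) ?mulr0n ?mul0r//.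
  by apply: contraNF ik => /eqP e; apply/eqP/val_inj; rewrite /= addnC in e *.
rewrite big1 // => i _; rewrite (_ : (k + j == i)%N = false) ?mulr0n ?mul0r//.
by apply: contraFF jk => /eqP ->.
Qed.

Lemma sum_fejer_form N (z : C) n k x y : N.-primitive_root z ->
  (n.+1 + k <= N)%N ->
  \sum_(s < N) (z ^+ s) ^+ k * fejer_form (z ^+ s) n x y =
  N%:R * (n.+1 - k)%:R * dot (iter k T x) y.
Proof.
move=> zN nkN; have N0 := prim_order_gt0 zN.
pose g j := dot (iter (j + k) T x) (iter j T y).
transitivity (N%:R * (\sum_(j < n.+1 - k) g j +
    \sum_(a < n) (\sum_(j < a.+1 - k) g j - \sum_(j < a.+1 - k) g j.+1))).
  rewrite mulrDr -(sum_fejer_vec 0 x y zN nkN N0) mulr_sumr.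
  rewrite (eq_bigr (fun a : 'I_n => \sum_(s < N) (z ^+ s) ^+ k *
     (dot (fejer_vec (z ^+ s) a.+1 x) (fejer_vec (z ^+ s) a.+1 y) -
      dot (T (fejer_vec (z ^+ s) a.+1 x)) (T (fejer_vec (z ^+ s) a.+1 y))))); last first.
    move=> a _; have akN : (a.+1 + k <= N)%N.
      by rewrite (leq_trans _ nkN)// leq_add2r ltnS ltnW.
    rewrite mulrBr -(sum_fejer_vec 0 x y zN akN N0).
    rewrite -(sum_fejer_vec 1 x y zN akN N0) -sumrB.
    by apply: eq_bigr => s _; rewrite -mulrBr.
  rewrite [X in _ = _ + X]exchange_big /= -big_split /=.
  by apply: eq_bigr => s _; rewrite /fejer_form mulrDr mulr_sumr.
rewrite -mulrA; congr (_ * _).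
have -> : dot (iter k T x) y = g 0%N by [].
(* Passing from [n] to [n.+1] adds [g (n.+1 - k)] through the longer vector and [g 0 - g (n.+1 - k)]
   through the new defect term, which telescopes: [g 0] in all. When [k > n.+1] every sum is empty
   and truncated subtraction gives 0 on the right. *)
elim: n {nkN} => [|n IH].
  rewrite big_ord0 addr0; case: k @g => [|k] g.
    by rewrite big_ord_recl big_ord0 addr0 mul1r.
  by rewrite subSS sub0n big_ord0 mul0r.
rewrite [X in _ + X = _]big_ord_recr /=.
have [kn|] := leqP k n.+1; last first.
  move=> kn; have -> : (n.+2 - k = 0)%N by apply/eqP; rewrite subn_eq0.
  have e : (n.+1 - k = 0)%N by apply/eqP; rewrite subn_eq0 ltnW.
  move: IH; rewrite e !big_ord0 subr0 !mul0r !add0r.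
  by move=> ->; rewrite addr0.
rewrite (subSn kn) big_ord_recr/=.
have -> : \sum_(j < n.+1 - k) g j - \sum_(j < n.+1 - k) g j.+1 = g 0%N - g (n.+1 - k)%N.
  rewrite -sumrB; elim: (n.+1 - k)%N => [|m IHm]; first by rewrite big_ord0 subrr.
  by rewrite big_ord_recr/= IHm; ring.
rewrite -[(n.+1 - k).+1]addn1 natrD mulrDl -IH; ring.
Qed.

Lemma iter_poly_op_bound p M x y : (forall w, `|w| = 1 -> `|p.[w]| <= M) ->
  forall n, (size p <= n.+1)%N ->
  `|\sum_(k < size p) p`_k * (n.+1 - k)%:R * dot (iter k T x) y| <=
    M * n.+1%:R * ((`|x| ^+ 2 + `|y| ^+ 2) / 2).
Proof.
(* Twice [n.+1] sample points are enough: each [k < size p <= n.+1] satisfies [n.+1 + k <= N]. *)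
move=> pM n pn; pose N := (n.+1 + n.+1)%N.
have [z zN] := @primitive_root_exists C N isT.
have N0 : 0 < N%:R :> C by rewrite ltr0n.
rewrite -(ler_pM2l N0) -{1}[N%:R]gtr0_norm// -normrM.
have -> : N%:R * (\sum_(k < size p) p`_k * (n.+1 - k)%:R * dot (iter k T x) y) =
   \sum_(s < N) p.[z ^+ s] * fejer_form (z ^+ s) n x y.
  under [RHS]eq_bigr do rewrite horner_coef mulr_suml.
  rewrite exchange_big /= mulr_sumr; apply: eq_bigr => k _.
  under eq_bigr do rewrite -mulrA.
  rewrite -mulr_sumr sum_fejer_form//; first by ring.
  by rewrite leq_add2l (leq_trans _ pn)// ltnW.
have M0 : 0 <= M by apply: le_trans (normr_ge0 _) (pM 1 (normr1 _)).
have sumB u : \sum_(s < N) fejer_form (z ^+ s) n u u = N%:R * n.+1%:R * `|u| ^+ 2.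
  rewrite dotE -[dot u u]/(dot (iter 0 T u) u) -[n.+1 in RHS]subn0 -(sum_fejer_form _ _ zN).
    by apply: eq_bigr => s _; rewrite expr0 mul1r.
  by rewrite addn0 leq_addl.
apply: le_trans (ler_norm_sum _ _ _) _.
apply: (@le_trans _ _ (\sum_(s < N) M *
  ((fejer_form (z ^+ s) n x x + fejer_form (z ^+ s) n y y) / 2))).
  apply: ler_sum => s _; rewrite normrM ler_pM// ?fejer_form_le_half// pM//.
  by rewrite normrX (normC_primitive_root zN) expr1n.
rewrite -mulr_sumr -mulr_suml big_split/= !sumB le_eqVlt; apply/orP; left; apply/eqP; ring.
Qed.

Lemma natmul_bounded_le0 (r d : C) n0 : r \is Num.real ->
  (forall n, (n0 <= n)%N -> n%:R * r <= d) -> r <= 0.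
Proof.
move=> /complex_realP[k ->] h.
have h' n : (n0 <= n)%N -> n%:R * k <= complex.Re d.
  move=> /h; rewrite lecE => /andP[_].
  by rewrite -(rmorph_nat (real_complex R)) -rmorphM.
rewrite lecR leNgt; apply/negP => k0.
pose n := (Num.truncn (complex.Re d / k)).+1.
have := h' (maxn n0 n) (leq_maxl _ _); apply/negP; rewrite -ltNge -ltr_pdivrMr//.
by rewrite (lt_le_trans (truncnS_gt _))// ler_nat leq_maxr.
Qed.

(** The Fejer weights split as [n.+1] minus [k]. The part with [k] is bounded by [D], which does not
    depend on [n], so letting [n] grow removes the weights. *)
Lemma poly_op_form_bound p M x y : (forall w, `|w| = 1 -> `|p.[w]| <= M) ->
  `|dot (poly_op T p x) y| <= M * ((`|x| ^+ 2 + `|y| ^+ 2) / 2).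
Proof.
move=> pM; set b := _ * (_ / _).
pose D := \sum_(k < size p) `|p`_k * k%:R * dot (iter k T x) y|.
have M0 : 0 <= M by apply: le_trans (normr_ge0 _) (pM 1 (normr1 _)).
rewrite -subr_le0; apply: (@natmul_bounded_le0 _ D (size p).+1).
  by rewrite rpredB// ger0_real// ?normr_ge0 ?mulr_ge0 ?divr_ge0 ?addr_ge0 ?exprn_ge0.
case=> // n; rewrite ltnS => pn.
have le1 := iter_poly_op_bound x y pM (leqW pn).
rewrite mulrBr lerBlDr.
apply: (@le_trans _ _
  (D + `|\sum_(k < size p) p`_k * (n.+1 - k)%:R * dot (iter k T x) y|)); last first.
  by rewrite lerD2l (le_trans le1)// le_eqVlt; apply/orP; left; apply/eqP; rewrite /b; ring.
rewrite -[X in X * `|_| <= _]ger0_norm ?ler0n// -normrM.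
have -> : n.+1%:R * dot (poly_op T p x) y =
   \sum_(k < size p) p`_k * k%:R * dot (iter k T x) y +
   \sum_(k < size p) p`_k * (n.+1 - k)%:R * dot (iter k T x) y.
  rewrite /poly_op dot_suml mulr_sumr -big_split/=; apply: eq_bigr => k _.
  rewrite dotZl natrB; last by rewrite ltnW// ltnS (leq_trans _ pn)// ltnW.
  ring.
by apply: le_trans (ler_normD _ _) _; rewrite lerD2r; exact: ler_norm_sum.
Qed.

Lemma von_neumann p M x : (forall w, `|w| = 1 -> `|p.[w]| <= M) ->
  `|poly_op T p x| <= M * `|x|.
Proof.
move=> pM; have M0 : 0 <= M by apply: le_trans (normr_ge0 _) (pM 1 (normr1 _)).
set y := poly_op T p x.
have [y0|y0] := eqVneq y 0; first by rewrite y0 normr0 mulr_ge0.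
have [x0|x0] := eqVneq x 0.
  suff y0' : y = 0 by rewrite y0' eqxx in y0.
  rewrite /y /poly_op x0 big1// => k _; rewrite (_ : iter k T 0 = 0) ?scaler0//.
  by elim: (k : nat) => //= m ->; rewrite linear0.
have nx : 0 < `|x| by rewrite normr_gt0.
have ny : 0 < `|y| by rewrite normr_gt0.
(* Rescaling [y] to the norm of [x] makes the arithmetic mean in the form bound equal to the product
   of the norms. *)
have ny2 : `|(`|x| / `|y|) *: y| = `|x|.
  by rewrite normrZ normrM normfV !normr_id divfK ?lt0r_neq0.
have := poly_op_form_bound x ((`|x| / `|y|) *: y) pM.
rewrite ny2 -/y dotZr -dotE normrM norm_conjC [X in X * _ <= _]normrM normfV normrX !normr_id.
have -> : `|x| / `|y| * `|y| ^+ 2 = `|x| * `|y| by field; exact: lt0r_neq0.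
have -> : (`|x| ^+ 2 + `|x| ^+ 2) / 2 = `|x| * `|x| by field.
by rewrite mulrCA ler_pM2l.
Qed.

End VonNeumann.

Lemma cauchy_seq_cvg (K : numFieldType) (V : completeNormedModType K) (u : nat -> V) :
  (forall e : K, 0 < e -> exists N, forall n m, (N <= n)%N -> (N <= m)%N ->
     `|u n - u m| <= e) ->
  exists l, forall e : K, 0 < e -> exists N, forall n, (N <= n)%N -> `|l - u n| <= e.
Proof.
move=> h.
have cu : cvgn u.
  apply/cauchy_cvgP; apply/cauchy_ballP => e e0; near_simpl.
  have [N hN] := h (e / 2) (divr_gt0 e0 (ltr0Sn _ 1)).
  exists ([set n | (N <= n)%N], [set n | (N <= n)%N]) => /=; first by split; exists N.
  move=> [n m] [/= Nn Nm]; rewrite -ball_normE /=.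
  by rewrite (le_lt_trans (hN _ _ Nn Nm))// ltr_pdivrMr ?ltr0n// ltr_pMr// ltr1n.
exists (limn u) => e e0.
have /cvgrPdist_le/(_ e e0) := cu; case=> N _ hN.
by exists N => n Nn; exact: hN.
Qed.

(** * Total boundedness and compact operators *)

Section TotalBoundedness.
Variables (R : realType) (H : completeNormedModType R[i]).
Local Notation C := R[i].

Definition totally_bounded (A : set H) := forall e : C, 0 < e ->
  exists s : seq H, forall x, A x -> exists2 c, c \in s & `|c - x| < e.

Lemma precompact_totally_bounded A : precompact A -> totally_bounded A.
Proof.
rewrite precompactE compact_cover => cA e e0.
have [||D _ hD] := cA H [set: H] (fun x => ball x e).
- by move=> x _; exact: ball_open.
- by move=> x _; exists x => //; exact: ballxx.
exists (finmap.enum_fset D) => x Ax.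
have [c cD cx] := hD x (subset_closure Ax).
by exists c => //; move: cx; rewrite -ball_normE.
Qed.

(** An ultrafilter containing [A] contains one ball of every finite cover of [A], at every radius;
    it is therefore Cauchy and converges by completeness. *)
Lemma totally_bounded_precompact A : totally_bounded A -> precompact A.
Proof.
move=> tA; rewrite precompactE compact_ultra => F FU FA.
have Fs (s : seq H) (e : C) (B : set H) : F B ->
  (forall x, B x -> exists2 c, c \in s & `|c - x| < e) -> exists c, F (ball c e).
  elim: s B => [|c s IH] B FB hB.
    have [x Bx] := filter_ex FB; by have [] := hB x Bx.
  have [Fc|Fc] := in_ultra_setVsetC (ball c e) FU; first by exists c.
  apply: (IH (B `&` ~` ball c e)); first exact: filterI.
  move=> x [Bx ncx]; have [d + dx] := hB x Bx.
  rewrite inE => /orP[/eqP dc|ds]; last by exists d.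
  by exfalso; apply: ncx; rewrite -ball_normE /= -dc.
have Fc : cauchy F.
  apply/cauchyP => e e0; have e2 : 0 < e / 2 by rewrite divr_gt0.
  have [s hs] := tA (e / 2) e2.
  apply: (Fs s e _ FA) => x /(_ (ball x (e / 2))) [|y [Ay]].
    exact: nbhsx_ballx.
  rewrite -ball_normE /= => xy; have [c cs cy] := hs y Ay.
  exists c => //; rewrite -(subrK y c) -addrA (le_lt_trans (ler_normD _ _))//.
  by rewrite [ltRHS]splitr ltrD// distrC.
have /cauchy_cvgP cF := Fc.
exists (lim F); split; last by [].
have PF : ProperFilter F by exact: ultra_proper.
by apply: (@closed_cvg _ _ F PF id (closure A)) => //; exact: closed_closure.
Qed.

Lemma compact_op_approx (D : H -> H) :
  (forall e : C, 0 < e -> exists K : H -> H, exists2 d : C, 0 < d &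
     compact_op K /\ forall x y, `|x| <= 1 -> `|y| <= 1 ->
       `|K x - K y| < d -> `|D x - D y| < e) ->
  compact_op D.
Proof.
move=> h; apply: totally_bounded_precompact => e e0.
have [K [d d0 [cK hK]]] := h e e0.
have [s hs] := precompact_totally_bounded cK (divr_gt0 d0 (ltr0Sn _ 1)).
pose P c x := `|x| <= 1 /\ `|c - K x| < d / 2.
(* Each centre of the net for [K] is pulled back to a point of the unit ball with image within
   [d / 2] of it. A centre without such a point contributes an arbitrary vector, a harmless extra
   element of the list. *)
exists [seq D (get (P c)) | c <- s] => _ [x x1 <-].
have [c cs cx] := hs (K x) (ex_intro2 _ _ x x1 erefl).
have [g1 gc] : P c (get (P c)) by apply: (getPex (P := P c)); exists x.
exists (D (get (P c))); first by apply/mapP; exists c.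
apply: hK => //; rewrite -[K _](subrK c) -addrA (le_lt_trans (ler_normD _ _))//.
by rewrite [ltRHS]splitr ltrD// distrC.
Qed.

End TotalBoundedness.

Lemma invS_eventually_le (R : realType) (r : R) : 0 < r ->
  exists N, forall n, (N <= n)%N -> n.+1%:R^-1 <= r.
Proof.
move=> r0; exists (Num.truncn r^-1) => n Nn.
rewrite -[r]invrK lef_pV2 ?posrE ?invr_gt0 ?ltr0n//.
by rewrite (le_trans (ltW (truncnS_gt _)))// ler_nat.
Qed.

(** * Riesz representation, the adjoint and the defect of a contraction *)

Section Hilbert.
Variables (R : realType) (H : completeNormedModType R[i]).
Local Notation C := R[i].
Variable dot : {dot H for @Num.conj C}.
Hypothesis dotE : hilbert_norm dot.

Lemma cauchy_schwarz (x y : H) : `|dot x y| <= `|x| * `|y|.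
Proof.
have [->|x0] := eqVneq x 0; first by rewrite linear0l !normr0 mul0r.
have [->|y0] := eqVneq y 0; first by rewrite linear0r !normr0 mulr0.
have nx : 0 < `|x| by rewrite normr_gt0.
have ny : 0 < `|y| by rewrite normr_gt0.
have unit (u : H) : u != 0 -> `|(`|u|^-1 : C) *: u| = 1.
  by move=> u0; rewrite normrZ normfV normr_id mulVf// normr_eq0.
have := dot_le_half dot ((`|x|^-1 : C) *: x) ((`|y|^-1 : C) *: y).
rewrite -!dotE (unit _ x0) (unit _ y0) !expr1n -[1 + 1]/2 divff ?pnatr_eq0//.
rewrite dotZl dotZr normrM normrM norm_conjC !normfV !normr_id.
by rewrite ler_pdivrMl// mulr1 ler_pdivrMl// mulrC.
Qed.

Section Riesz.
Variables (f : H -> C) (m : R).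
Hypothesis fl : forall a x y, f (a *: x + y) = a * f x + f y.

Let J x : R := complex.Re (dot x x) - 2 * complex.Re (f x).

(** The steps [t = 1] and [t = 1/2] yield the parallelogram law; a step against the gradient
    [dot v x - f v] yields the first-order condition. *)
Let JE (t : C) x v : J (t *: v + x) = J x +
  2 * complex.Re (t * (dot v x - f v)) +
  (complex.Re t ^+ 2 + complex.Im t ^+ 2) * complex.Re (dot v v).
Proof.
rewrite /J fl !(dotDl, dotDr) !(dotZl, dotZr) (dotC dot v x).
have := ger0_Im (dnorm_ge0 dot v).
case: (dot v x) => a b; case: (dot v v) => p q /= ->.
case: (dot x x) => c d; case: (f x) => e g; case: (f v) => h k; case: t => t1 t2 /=.
ring.
Qed.

(* The minimizing sequences of [|x|^2 - 2 Re f x] are Cauchy by the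
   parallelogram law, and their limit represents [f]. *)
Lemma riesz_variational : (forall x, m <= J x) -> exists z, forall x, f x = dot x z.
Proof.
move=> Jm; pose S := range J.
have infS : has_inf S by split; [exists (J 0), 0|exists m => _ [x _ <-]].
have Jinf x : inf S <= J x by apply: ge_inf; [exact: infS.2|exists x].
have xP n : exists x, J x < inf S + n.+1%:R^-1.
  have n0 : 0 < n.+1%:R^-1 :> R by rewrite invr_gt0 ltr0n.
  by have [_ [x _ <-] h] := inf_adherent n0 infS; exists x.
pose u n := projT1 (cid (xP n)).
have uP n : J (u n) < inf S + n.+1%:R^-1 := projT2 (cid (xP n)).
have nsq (x : H) : `|x| ^+ 2 = (complex.Re (dot x x))%:C.
  by rewrite dotE RRe_real// ger0_real// dnorm_ge0.
have Lu n k : complex.Re (dot (u n - u k) (u n - u k)) <= 2 * n.+1%:R^-1 + 2 * k.+1%:R^-1.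
  (* For the midpoint [w] this amounts to [J w = (J (u n) + J (u k)) / 2 - q / 4], and [J w] is at
     least the infimum. *)
  have := JE 1 (u k) (u n - u k); rewrite scale1r subrK mul1r.
  have := JE (2^-1%:C) (u k) (u n - u k).
  set w := _ *: _ + _; set a := dot _ _ - f _; set q := complex.Re (dot (u n - u k) _).
  have -> : complex.Re (2^-1%:C * a) = complex.Re a / 2.
    by case: a => a1 a2 /=; field.
  rewrite /= expr0n/= expr1n !addr0 => e1 e2.
  have := Jinf w; have := uP n; have := uP k; rewrite e1 e2.
  have -> : 2^-1 ^+ 2 = 4^-1 :> R by field.
  move: (J (u k)) (inf S) (k.+1%:R^-1) (n.+1%:R^-1) (complex.Re a) => A B D E F; lra.
have sqr_le (w : H) (e : C) q : 0 < e -> `|w| ^+ 2 <= q%:C ->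
    q <= complex.Re e ^+ 2 -> `|w| <= e.
  move=> e0 wq qe; have er : e = (complex.Re e)%:C by rewrite RRe_real// gtr0_real.
  rewrite -(ler_pXn2r (n := 2)) ?nnegrE ?(ltW e0)// (le_trans wq)//.
  by rewrite [X in _ <= X ^+ _]er -rmorphXn lecR.
have Re_gt0 (e : C) : 0 < e -> 0 < complex.Re e by rewrite ltcE => /andP[].
have [z zP] : exists l, forall e : C, 0 < e -> exists N, forall n, (N <= n)%N -> `|l - u n| <= e.
  apply: cauchy_seq_cvg => e e0.
  have e4 : 0 < complex.Re e ^+ 2 / 4 by rewrite divr_gt0// exprn_gt0// Re_gt0.
  have [N hN] := invS_eventually_le e4; exists N => n k Nn Nk.
  apply: (sqr_le _ _ (complex.Re (dot (u n - u k) (u n - u k))) e0); first by rewrite nsq.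
  apply: le_trans (Lu n k) _; move: (hN n Nn) (hN k Nk).
  by move: (n.+1%:R^-1) (k.+1%:R^-1) (complex.Re e ^+ 2) => A B D; lra.
have uf v n : `|dot v (u n) - f v| ^+ 2 <= ((1 + complex.Re (dot v v)) / n.+1%:R)%:C.
  set a := _ - _; set q := complex.Re _.
  have q0 : 0 <= q by have := dnorm_ge0 dot v; rewrite lecE => /andP[].
  have s0 : 0 < 1 + q by rewrite ltr_wpDr.
  pose A := complex.Re a ^+ 2 + complex.Im a ^+ 2.
  have A0 : 0 <= A by rewrite addr_ge0// sqr_ge0.
  (* This step lowers [J] by at least [|a|^2 / (1 + q)], which cannot exceed the gap [n.+1%:R^-1] to
     the infimum. Dividing by [1 + q] instead of [q] covers [v = 0]. *)
  have := JE (- (1 + q)^-1%:C * (complex.Re a -i* complex.Im a)) (u n) v.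
  set w := _ *: _ + _; rewrite -/a -/q => e.
  have {}e : J w = J (u n) - 2 * ((1 + q)^-1 * A) + (1 + q)^-1 ^+ 2 * A * q.
    by rewrite e /A; case: (a) => a1 a2 /=; ring.
  have h : (1 + q)^-1 * A <= n.+1%:R^-1.
    have h1 : (1 + q)^-1 ^+ 2 * A * q <= (1 + q)^-1 * A.
      rewrite expr2 -!mulrA ler_pM2l ?invr_gt0// ler_pdivrMl//.
      by move: A0; move: (A) => B; nra.
    have := Jinf w; have := uP n; rewrite e; move: h1.
    by move: ((1 + q)^-1 * A) (_ * A * q) (J (u n)) (inf S) (n.+1%:R^-1) => a1 a2 a3 a4 a5; lra.
  rewrite -add_Re2_Im2 lecR -/A; move: h; rewrite ler_pdivrMl//.
have vanish v : dot v z - f v = 0.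
  apply/eqP; apply: contraT; rewrite -normr_gt0; set d := `|_| => d0.
  have d4 : 0 < d / 4 by rewrite divr_gt0.
  have v1 : 0 < `|v| + 1 by rewrite ltr_wpDl.
  have [N1 h1] := zP _ (divr_gt0 d4 v1).
  have q0 : 0 <= complex.Re (dot v v) by have := dnorm_ge0 dot v; rewrite lecE => /andP[].
  have q1 : 0 < 1 + complex.Re (dot v v) by rewrite ltr_wpDr.
  have e4 : 0 < complex.Re (d / 4) ^+ 2 / (1 + complex.Re (dot v v)).
    by rewrite divr_gt0// exprn_gt0// Re_gt0.
  have [N2 h2] := invS_eventually_le e4.
  pose n := maxn N1 N2.
  have b1 : `|dot v (z - u n)| <= d / 4.
    rewrite (le_trans (cauchy_schwarz _ _))//.
    rewrite (@le_trans _ _ (`|v| * (d / 4 / (`|v| + 1))))//.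
      by rewrite ler_wpM2l// h1// leq_maxl.
    by rewrite mulrCA ler_piMr ?(ltW d4)// ler_pdivrMr// mul1r lerDl.
  have b2 : `|dot v (u n) - f v| <= d / 4.
    have dr : d / 4 = (complex.Re (d / 4))%:C by rewrite RRe_real// gtr0_real.
    rewrite -(ler_pXn2r (n := 2)) ?nnegrE ?(ltW d4)// (le_trans (uf v n))//.
    rewrite [X in _ <= X ^+ _]dr -rmorphXn lecR.
    by have := h2 n (leq_maxr _ _); rewrite ler_pdivlMr// mulrC.
  have : d <= d / 4 + d / 4.
    have e : d = `|dot v (z - u n) + (dot v (u n) - f v)| by rewrite dotBr addrA subrK.
    by rewrite {1}e (le_trans (ler_normD _ _))// lerD.
  have d2 : 0 < d / 2 by rewrite divr_gt0.
  rewrite -subr_ge0 (_ : _ - d = - (d / 2)); last by field.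
  by rewrite oppr_ge0 => /(lt_le_trans d2); rewrite ltxx.
by exists z => v; apply/esym/eqP; rewrite -subr_eq0 vanish.
Qed.

End Riesz.

Variable T : {linear H -> H}.
Hypothesis T1 : Defs.contraction T.

Lemma adjointP x y : dot (T x) y = dot x (adjoint dot T y).
Proof.
suff [z zP] : exists z, forall x, dot (T x) y = dot x z.
  have : [set z | forall x, dot (T x) y = dot x z] (adjoint dot T y).
    by apply: getPex; exists z.
  exact.
(* Completing the square: [|T u - y|^2 >= 0] and [|T u| <= |u|] give
   [|u|^2 - 2 Re <T u, y> >= - |y|^2]. *)
apply: (@riesz_variational (fun x => dot (T x) y) (- complex.Re (dot y y))).
  by move=> a u v; rewrite linearP dotDl dotZl.
move=> u; have := dnorm_ge0 dot (T u - y).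
have := defect_ge0 dotE T1 u.
rewrite !(dotBl, dotBr) (dotC dot (T u) y).
rewrite !lecE => /andP[_ h1] /andP[_].
move: h1; case: (dot (T u) y) => a b; case: (dot (T u) (T u)) => c d.
by case: (dot u u) => e g; case: (dot y y) => h k /=; lra.
Qed.

Lemma adjoint_sub x y : adjoint dot T (x - y) = adjoint dot T x - adjoint dot T y.
Proof.
apply/eqP; rewrite -subr_eq0 -(dnorm_eq0 dot); set w := (X in dot X X).
by rewrite {2}/w !dotBr -!adjointP dotBr; apply/eqP; ring.
Qed.

Lemma adjoint_contraction y : `|adjoint dot T y| <= `|y|.
Proof.
set z := adjoint dot T y.
have [->|z0] := eqVneq z 0; first by rewrite normr0.
have := cauchy_schwarz (T z) y; rewrite adjointP -/z -dotE normrX normr_id => h.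
have nz : 0 < `|z| by rewrite normr_gt0.
by rewrite -(ler_pM2l nz) -expr2 (le_trans h)// ler_wpM2r//; exact: T1.
Qed.

(** The left side expands to [|x|^2 - 2 |T x|^2 + |T^* T x|^2], and the adjoint is a contraction. *)
Lemma defect_norm x : `|x - adjoint dot T (T x)| ^+ 2 <= `|x| ^+ 2 - `|T x| ^+ 2.
Proof.
have := adjoint_contraction (T x).
rewrite -(ler_pXn2r (n := 2)) ?nnegrE// => h.
rewrite [in leLHS]dotE. rewrite !(dotBl dot, dotBr dot) -adjointP -!dotE.
rewrite [dot (adjoint _ _ _) x]dotC -adjointP -!dotE conj_Creal ?rpredX ?normr_real//.
rewrite -subr_ge0; rewrite -subr_ge0 in h.
rewrite (_ : _ - _ = `|T x| ^+ 2 - `|adjoint dot T (T x)| ^+ 2)//; ring.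
Qed.

End Hilbert.

(** * The resolvent set is open *)

Section Resolvent.
Variables (R : realType) (H : completeNormedModType R[i]).
Local Notation C := R[i].

Lemma half_contraction_fixpoint (g : H -> H) :
  (forall x y, `|g x - g y| <= `|x - y| / 2) ->
  exists y, y = g y.
Proof.
move=> gl; pose u n := iter n g 0; pose M := `|g 0| * 2.
have M0 : 0 <= M by rewrite mulr_ge0.
have bu n : `|u n| <= M.
  elim: n => [|n IH]; first by rewrite /u/= normr0.
  rewrite /u iterS -/(u n) -(subrK (g 0) (g (u n))) (le_trans (ler_normD _ _))//.
  apply: (@le_trans _ _ (M / 2 + `|g 0|)).
    by rewrite lerD2r (le_trans (gl _ _))// subr0 ler_pM2r ?invr_gt0.
  by rewrite /M mulfK ?pnatr_eq0// mulr2n mulrDr mulr1.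
have du n k : `|u (n + k)%N - u n| <= M / 2 ^+ n.
  elim: n => [|n IH]; first by rewrite add0n subr0 expr0 divr1 bu.
  rewrite addSn /u !iterS (le_trans (gl _ _))// exprSr invfM mulrA.
  by rewrite ler_pM2r ?invr_gt0.
have small (e : C) : 0 < e -> exists N, M / 2 ^+ N <= e.
  move=> e0; have Mr : M = (complex.Re M)%:C by rewrite RRe_real// ger0_real.
  have er : e = (complex.Re e)%:C by rewrite RRe_real// gtr0_real.
  have e0' : 0 < complex.Re e by move: e0; rewrite er ltcR.
  have M0' : 0 <= complex.Re M by move: M0; rewrite Mr lecR.
  pose N := (Num.truncn (complex.Re M / complex.Re e)).+1; exists N.
  have h : complex.Re M / complex.Re e <= 2 ^+ N.
    rewrite (le_trans (ltW (truncnS_gt _)))// -natrX ler_nat.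
    by have := ltn_expl N (ltnSn 1) => /ltnW.
  rewrite ler_pdivrMr ?exprn_gt0// Mr er -(rmorph_nat (real_complex R)) -rmorphXn -rmorphM lecR.
  by rewrite mulrC -ler_pdivrMr.
have [y yP] : exists l, forall e : C, 0 < e -> exists N, forall n, (N <= n)%N -> `|l - u n| <= e.
  apply: cauchy_seq_cvg => e e0.
  have [N hN] := small (e / 2) (divr_gt0 e0 (ltr0Sn _ 1)).
  exists N => n m Nn Nm.
  have h k : (N <= k)%N -> `|u k - u N| <= e / 2.
    by move=> Nk; rewrite -(subnKC Nk) (le_trans (du _ _)).
  rewrite -(subrKA (u N)) (le_trans (ler_normD _ _))// [leRHS]splitr lerD ?h//.
  by rewrite distrC h.
exists y; apply/eqP; rewrite -subr_eq0 -normr_eq0; apply: contraT => d0.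
have d4 : 0 < `|y - g y| / 4 by rewrite divr_gt0// lt_def d0 normr_ge0.
have [N hN] := yP _ d4.
have : `|y - g y| <= `|y - g y| / 4 + `|y - g y| / 4 / 2.
  rewrite -{1}(subrKA (u N.+1)) (le_trans (ler_normD _ _))// lerD ?hN//.
  by rewrite /u iterS (le_trans (gl _ _))// ler_pM2r ?invr_gt0// distrC hN.
have d2 : 0 < `|y - g y| * 5 / 8 by rewrite divr_gt0// mulr_gt0// lt_def d0 normr_ge0.
rewrite -subr_ge0 (_ : _ - `|y - g y| = - (`|y - g y| * 5 / 8)); last by field.
by rewrite oppr_ge0 => /(lt_le_trans d2); rewrite ltxx.
Qed.

(** The inverse at [z] is [(1 - c S0)^-1 S0] with [c = z - z0], obtained pointwise as the fixed
    point of [y = S0 x + c S0 y]. The radius [1 / (2 M)] makes [c S0] halve distances. *)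
Lemma resolvent_open (T : {linear H -> H}) (z0 : C) : ~ spectrum T z0 ->
  exists2 d : C, 0 < d & forall z, `|z - z0| < d -> ~ spectrum T z.
Proof.
move=> /contrapT[S0 [S0c S0T TS0]].
have /linear_boundedP/pinfty_ex_gt0[M M0 S0M] := continuous_linear_bounded 0 (S0c 0).
exists (1 / (2 * M)) => [|z]; first by rewrite divr_gt0// mulr_gt0.
rewrite ltr_pdivlMr ?mulr_gt0//; set c := z - z0 => cd.
have cM : `|c| * M <= 2^-1 by rewrite -div1r ler_pdivlMr// -mulrA (mulrC M) ltW.
have cl x y : `|c *: S0 x - c *: S0 y| <= `|x - y| / 2.
  rewrite -scalerBr -linearB/= normrZ (le_trans (ler_wpM2l _ (S0M _)))//.
  by rewrite mulrA mulrC ler_wpM2l.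
have ex x : exists y, y = S0 x + c *: S0 y.
  apply: half_contraction_fixpoint => y y'.
  by rewrite opprD addrACA subrr add0r cl.
pose S x := projT1 (cid (ex x)).
have SE x : S x = S0 x + c *: S0 (S x) := projT2 (cid (ex x)).
(* [S] is only a pointwise choice; its linearity and the left inverse identity both come from
   uniqueness of the fixed point. *)
have uniq x y : y = S0 x + c *: S0 y -> y = S x.
  move=> yE; apply/eqP; rewrite -subr_eq0 -normr_eq0; apply: contraT => d0.
  have : `|y - S x| <= `|y - S x| / 2.
    by rewrite {1}yE {1}SE opprD addrACA subrr add0r cl.
  rewrite ler_pdivlMr// ger_pMr ?lt_def ?d0//= => h.
  by have := lt_le_trans (ltr1n C 2) h; rewrite ltxx.
have Slin : linear S.
  move=> a x y; apply/esym/uniq; rewrite !linearP/= {1}(SE x) {1}(SE y).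
  by rewrite !scalerDr !scalerA (mulrC a c) addrACA -!scalerA -!scalerDr.
pose Sm := GRing.isLinear.Build _ _ _ _ S Slin.
pose SL : {linear H -> H} := HB.pack S Sm.
apply; exists SL; split => [|x|x].
- apply: bounded_linear_continuous; apply/linear_boundedP.
  near=> r => x; apply: (@le_trans _ _ (2 * M * `|x|)).
    have h : `|S x| <= M * `|x| + `|S x| / 2.
      rewrite {1}SE (le_trans (ler_normD _ _))// lerD//.
      by have := cl (S x) 0; rewrite linear0 scaler0 !subr0.
    rewrite -subr_ge0; rewrite -subr_ge0 in h.
    rewrite (_ : _ - _ = 2 * (M * `|x| + `|S x| / 2 - `|S x|)) ?mulr_ge0//.
    by field.
  by rewrite ler_wpM2r//; near: r; apply: nbhs_pinfty_ge; rewrite ger0_real// mulr_ge0// ltW.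
- apply/esym/uniq; rewrite -[in LHS](S0T x) -linearZ -linearD; congr (S0 _).
  by rewrite /c scalerBl addrA subrK.
- change (T (S x) - z *: S x = x).
  have e : S x = S0 (x + c *: S x) by rewrite linearD linearZ/= -SE.
  have := TS0 (x + c *: S x); rewrite -e /c scalerBl addrA => /addIr ->.
  by rewrite addrK.
Unshelve. all: by end_near. Qed.

End Resolvent.

(** * Covering a compact null set of the circle by small disks *)

Section CircleCover.
Variable R : realType.
Local Notation C := R[i].

Definition circle_point (t : R) : C := cos t +i* sin t.

Lemma circle_point_norm t : `|circle_point t| = 1.
Proof. by rewrite normc_def /= cos2Dsin2 sqrtr1. Qed.

Lemma circle_pointP (z : C) : `|z| = 1 ->
  exists2 t, 0 <= t <= 2 * pi & z = circle_point t.
Proof.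
case: z => a b; rewrite normc_def /= => -[/(congr1 (fun x => x ^+ 2))].
rewrite expr1n sqr_sqrtr ?addr_ge0 ?sqr_ge0// => ab.
have a1 : -1 <= a <= 1.
  by rewrite -ler_norml -(ler_pXn2r (n := 2)) ?nnegrE// expr1n -normrX ger0_norm ?sqr_ge0//; nra.
have ca : cos (acos a) = a by apply: acosK; rewrite in_itv.
have sa : sin (acos a) = `|b|.
  by rewrite sin_acos// -sqrtr_sqr; congr Num.sqrt; lra.
have p0 := pi_ge0 R; have h0 := acos_ge0 a1; have h1 := acos_lepi a1.
have [b0|b0] := leP 0 b.
  exists (acos a); first by apply/andP; split=> //; lra.
  by rewrite /circle_point ca sa ger0_norm.
exists (- acos a + pi *+ 2); first by apply/andP; split; rewrite mulr2n; lra.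
by rewrite /circle_point cosD2pi sinD2pi cosN sinN ca sa ltr0_norm// opprK.
Qed.

Lemma lipschitz_of_derivative_le1 (f df : R -> R) x y :
  (forall t : R, is_derive t (1 : R) f (df t)) -> (forall t, `|df t| <= 1) ->
  `|f x - f y| <= `|x - y|.
Proof.
move=> fd d1; wlog xy : x y / y <= x.
  by move=> h; have [/h//|/ltW/h] := leP y x; rewrite distrC (distrC y).
have [|c _ ->] := @MVT_segment R f df y x xy (fun t _ => fd t).
  apply: continuous_subspaceT => t.
  by apply/differentiable_continuous/derivable1_diffP; exact: ex_derive.
by rewrite normrM ler_piMl.
Qed.

Lemma circle_point_lipschitz t s :
  `|circle_point t - circle_point s| <= (2 * `|t - s|)%:C.
Proof.
have -> : circle_point t - circle_point s = (cos t - cos s)%:C + (sin t - sin s)%:C * 'i%C.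
  by rewrite /circle_point; simpc.
rewrite (le_trans (ler_normD _ _))// normrM !normc_def /=.
rewrite !expr0n/= !addr0 add0r expr1n sqrtr1 mulr1 -rmorphD lecR !sqrtr_sqr mulr2n mulrDl mul1r.
apply: lerD.
  apply: (lipschitz_of_derivative_le1 (df := fun t => - sin t)) => u.
  by rewrite normrN ler_norml sin_geN1 sin_le1.
apply: (lipschitz_of_derivative_le1 (df := cos)) => u.
by rewrite ler_norml cos_geN1 cos_le1.
Qed.

Lemma null_open_itv_cover (A : set R) (e : R) :
  (@lebesgue_measure R).-negligible A -> 0 < e ->
  exists F : nat -> R * R, (forall t, A t -> exists k, (F k).1 < t < (F k).2) /\
    (forall k, (F k).1 <= (F k).2) /\
    forall n, \sum_(k < n) ((F k).2 - (F k).1) <= e.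
Proof.
move=> /negligible_outer_measure; rewrite outer_measure_open_itv_cover => A0 e0.
have : ereal_inf [set (\sum_(k <oo) wlength idfun (F k))%E | F in open_itv_cover A] \is a fin_num.
  by rewrite A0.
move=> /(lb_ereal_inf_adherent e0)[_ [G [Gitv AG] <-]].
rewrite A0 add0e => Ge.
have [ab abP] := choice Gitv.
(* Reversed endpoints describe an empty interval; replacing them by [(0, 0)] makes every length a
   nonnegative difference. *)
exists (fun k => if (ab k).1 < (ab k).2 then ab k else (0, 0)); split; [|split].
- move=> t /AG[k _]; rewrite abP /= in_itv/= => /andP[h1 h2]; exists k.
  by rewrite (lt_trans h1 h2) h1.
- by move=> k; case: ifP => // /ltW.
move=> n; rewrite -lee_fin -sumEFin ltW// (le_lt_trans _ Ge)//.
pose J k := if (ab k).1 < (ab k).2 then ab k else (0, 0).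
rewrite -(big_mkord xpredT (fun k => ((J k).2 - (J k).1)%:E)) /J.
apply: le_trans (nneseries_lim_ge n _); last by move=> k _ _; rewrite abP; apply: wlength_itv_ge0.
apply: lee_sum => k _; rewrite abP wlength_itv /= lte_fin.
by case: ifP => //= _; rewrite subrr.
Qed.

(** Compactness makes the cover finite, so that a sum of one bump per disk stays approximable by
    polynomials. The centres lie in [E], so a point far from [E] is far from each of them. *)
Lemma null_circle_cover (E : set C) (e : R) :
  (forall z, E z -> `|z| = 1) ->
  (forall z, ~ E z -> `|z| = 1 -> exists2 d : C, 0 < d &
     forall w, `|w| = 1 -> `|w - z| < d -> ~ E w) ->
  circle_null E -> 0 < e -> (exists z, E z) ->
  exists (n : nat) (c : nat -> C) (l : nat -> R),
    [/\ forall k, E (c k), forall k, 0 < l k, \sum_(k < n) l k <= e &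
        forall z, E z -> exists2 k, (k < n)%N & `|z - c k| <= (l k)%:C].
Proof.
move=> E1 Ecl E0 e0 [z0 Ez0].
have e8 : 0 < e / 8 by rewrite divr_gt0.
have [F [FA [Fle Fs]]] := null_open_itv_cover E0 e8.
pose A := [set t | 0 <= t <= 2 * pi /\ E (circle_point t)].
(* [circle_null] speaks of angles in [[0, 2 pi)], while compactness wants the closed interval;
   interval 0, of length [e / 8], takes care of the endpoint. *)
pose G k := if k is k'.+1 then F k' else (2 * pi - e / 16, 2 * pi + e / 16).
have Gle k : (G k).1 <= (G k).2 by case: k => //=; lra.
have Gs n : \sum_(k < n) ((G k).2 - (G k).1) <= e / 4.
  case: n => [|n]; first by rewrite big_ord0; lra.
  by rewrite big_ord_recl /= ; have := Fs n; lra.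
have cA : compact A.
  have -> : A = `[0, 2 * pi]%classic `&` [set t | E (circle_point t)].
    by apply/seteqP; split => t /=; rewrite in_itv.
  apply: compact_closedI; first exact: segment_compact.
  rewrite -[X in closed X]setCK; apply: open_closedC; rewrite openE => t /= nEt.
  have [d d0 dP] := Ecl _ nEt (circle_point_norm t).
  have dr : d = (complex.Re d)%:C by rewrite RRe_real// gtr0_real.
  have d0' : 0 < complex.Re d by move: d0; rewrite dr ltcR.
  apply/nbhs_ballP; exists (complex.Re d / 2) => [|s]; first by rewrite /= divr_gt0.
  rewrite -ball_normE /= => ts; apply: dP; first exact: circle_point_norm.
  by rewrite (le_lt_trans (circle_point_lipschitz _ _))// dr ltcR mulrC -ltr_pdivlMr// distrC.
move: cA; rewrite compact_cover => /(_ nat [set: nat] (fun k => `](G k).1, (G k).2[%classic)).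
case=> [k _|t [/andP[t0 t2] Et]|D _ DA]; first exact: interval_open.
  move: t2; rewrite le_eqVlt => /orP[/eqP t2|t2].
    by exists 0%N => //=; rewrite in_itv/= t2; apply/andP; split; lra.
  have [k /andP[h1 h2]] : exists k, (F k).1 < t < (F k).2 by apply: FA; split => //; rewrite t0 t2.
  by exists k.+1 => //=; rewrite in_itv/= h1.
pose n := (\max_(k <- finmap.enum_fset D) k).+1.
have cP k : exists c, E c /\ ((exists2 t, (G k).1 < t < (G k).2 & E (circle_point t)) ->
    exists2 t, (G k).1 < t < (G k).2 & c = circle_point t).
  have [[t tG Et]|no] := pselect (exists2 t, (G k).1 < t < (G k).2 & E (circle_point t)).
    by exists (circle_point t); split => // _; exists t.
  by exists z0; split.
have [c {}cP] := choice cP.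
(* The factor 2 is the Lipschitz constant of [circle_point], and the extra term makes the radius
   positive even for an empty interval. The total is at most [2 (e / 4) + e / 2 = e]. *)
exists n, c, (fun k => 2 * ((G k).2 - (G k).1) + e / (2 * n%:R)); split.
- by move=> k; have [] := cP k.
- move=> k; apply: ltr_wpDl; last by rewrite divr_gt0// mulr_gt0// ltr0n.
  by rewrite mulr_ge0// subr_ge0.
- rewrite big_split/= sumr_const card_ord -[_ *+ n]mulr_natr -mulr_sumr.
  have -> : e / (2 * n%:R) * n%:R = e / 2 by field; rewrite pnatr_eq0.
  by have := Gs n; lra.
- move=> z Ez; have [t t02 zt] := circle_pointP (E1 z Ez).
  have [|k /= kD] := DA t; first by split => //; rewrite -zt.
  rewrite in_itv/= => tk; exists k.
    by rewrite ltnS; apply: (@leq_bigmax_seq _ _ xpredT id).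
  have [_ [|s sk ->]] := cP k; first by exists t; rewrite // -zt.
  rewrite zt (le_trans (circle_point_lipschitz _ _))// lecR.
  have n0 : 0 < e / (2 * n%:R) by rewrite divr_gt0// mulr_gt0// ltr0n.
  have : `|t - s| <= (G k).2 - (G k).1.
    by move: tk sk => /andP[? ?] /andP[? ?]; rewrite ler_norml; apply/andP; split; lra.
  by move: n0; move: (e / _) => q; lra.
Qed.

End CircleCover.

(** * Uniform limits of polynomials and functions large on a null set *)

Section PolynomialApproximation.
Variable R : realType.
Local Notation C := R[i].
Implicit Types (f g : C -> C).

Lemma gt0_realC (e : C) : 0 < e -> exists2 r : R, 0 < r & e = r%:C.
Proof.
move=> e0; have er : e = (complex.Re e)%:C by rewrite RRe_real// gtr0_real.
by exists (complex.Re e) => //; move: e0; rewrite er ltcR.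
Qed.

Lemma ReD (z w : C) : complex.Re (z + w) = complex.Re z + complex.Re w.
Proof. by case: z; case: w. Qed.

Lemma Re_le_norm (z : C) : (complex.Re z)%:C <= `|z|.
Proof. by apply: le_trans (normc_ge_Re z); rewrite lecR ler_norm. Qed.

(** A working substitute for the disk algebra: only the values on the closed disk count, and sums,
    products, uniform limits and suitable inverses need no complex analysis. *)
Definition poly_approx f := forall e : C, 0 < e ->
  exists p : {poly C}, forall z, `|z| <= 1 -> `|p.[z] - f z| <= e.

Lemma poly_approx_poly (p : {poly C}) : poly_approx (horner p).
Proof. by move=> e e0; exists p => z _; rewrite subrr normr0 ltW. Qed.

Lemma horner_bounded (p : {poly C}) :
  exists2 M : C, 0 < M & forall z, `|z| <= 1 -> `|p.[z]| <= M.
Proof.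
exists (\sum_(k < size p) `|p`_k| + 1) => [|z z1].
  by rewrite ltr_wpDl// sumr_ge0.
rewrite horner_coef (le_trans (ler_norm_sum _ _ _))// ler_wpDr// ler_sum// => k _.
by rewrite normrM normrX ler_piMr// exprn_ile1.
Qed.

Lemma horner_lipschitz (p : {poly C}) : exists2 L : C, 0 < L &
  forall z w, `|z| <= 1 -> `|w| <= 1 -> `|p.[z] - p.[w]| <= L * `|z - w|.
Proof.
elim/poly_ind: p => [|p c [L L0 pL]].
  by exists 1 => // z w _ _; rewrite !horner0 subrr normr0 mul1r.
have [M M0 pM] := horner_bounded p.
exists (M + L) => [|z w z1 w1]; first exact: addr_gt0.
rewrite !hornerMXaddC opprD addrACA subrr addr0.
have -> : p.[z] * z - p.[w] * w = p.[z] * (z - w) + (p.[z] - p.[w]) * w by ring.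
rewrite (le_trans (ler_normD _ _))// [leRHS]mulrDl lerD// normrM.
  by rewrite ler_wpM2r// pM.
by rewrite (le_trans _ (pL z w z1 w1))// ler_piMr.
Qed.

Lemma poly_approx_bounded f : poly_approx f ->
  exists2 M : C, 0 < M & forall z, `|z| <= 1 -> `|f z| <= M.
Proof.
move=> /(_ 1 ltr01)[p pf]; have [M M0 pM] := horner_bounded p.
exists (M + 1) => [|z z1]; first exact: addr_gt0.
rewrite -(subrK p.[z] (f z)) addrC (le_trans (ler_normD _ _))// lerD ?pM//.
by rewrite distrC pf.
Qed.

Lemma poly_approx_unif_continuous f : poly_approx f -> forall e : C, 0 < e ->
  exists2 d : C, 0 < d & forall z w, `|z| <= 1 -> `|w| <= 1 -> `|z - w| <= d ->
    `|f z - f w| <= e.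
Proof.
move=> fp e e0; have e3 : 0 < e / 3 by rewrite divr_gt0.
have [p pf] := fp _ e3; have [L L0 pL] := horner_lipschitz p.
exists (e / 3 / L) => [|z w z1 w1 zw]; first exact: divr_gt0.
have -> : f z - f w = - (p.[z] - f z) + (p.[z] - p.[w]) + (p.[w] - f w) by ring.
have -> : e = e / 3 + e / 3 + e / 3 by field.
rewrite (le_trans (ler_normD _ _))// lerD ?pf// (le_trans (ler_normD _ _))//.
by rewrite normrN lerD ?pf// (le_trans (pL _ _ z1 w1))// -ler_pdivlMl// mulrC.
Qed.

Lemma poly_approx_ext f g : (forall z, `|z| <= 1 -> f z = g z) ->
  poly_approx f -> poly_approx g.
Proof.
move=> fg fp e /fp[p pf]; exists p => z z1; rewrite -fg//; exact: pf.
Qed.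

Lemma poly_approxD f g : poly_approx f -> poly_approx g ->
  poly_approx (fun z => f z + g z).
Proof.
move=> fp gp e e0; have e2 : 0 < e / 2 by rewrite divr_gt0.
have [p pf] := fp _ e2; have [q qg] := gp _ e2.
exists (p + q) => z z1; rewrite hornerD opprD addrACA [leRHS]splitr.
by rewrite (le_trans (ler_normD _ _))// lerD ?pf ?qg.
Qed.

Lemma poly_approxM f g : poly_approx f -> poly_approx g ->
  poly_approx (fun z => f z * g z).
Proof.
move=> fp gp e e0.
have [M M0 gM] := poly_approx_bounded gp.
have eM : 0 < e / 2 / M by rewrite !divr_gt0.
have [p pf] := fp _ eM; have [N N0 pN] := horner_bounded p.
have eN : 0 < e / 2 / N by rewrite !divr_gt0.
have [q qg] := gp _ eN.
exists (p * q) => z z1; rewrite hornerM.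
have -> : p.[z] * q.[z] - f z * g z = p.[z] * (q.[z] - g z) + (p.[z] - f z) * g z by ring.
rewrite [leRHS]splitr (le_trans (ler_normD _ _))// !normrM lerD//.
  by rewrite -[leRHS](divfK (lt0r_neq0 N0)) mulrC ler_pM ?qg ?pN.
by rewrite -[leRHS](divfK (lt0r_neq0 M0)) ler_pM ?pf ?gM.
Qed.

Lemma poly_approx_lim f : (forall e : C, 0 < e -> exists2 g, poly_approx g &
    forall z, `|z| <= 1 -> `|g z - f z| <= e) -> poly_approx f.
Proof.
move=> h e e0; have e2 : 0 < e / 2 by rewrite divr_gt0.
have [g gp gf] := h _ e2; have [p pg] := gp _ e2; exists p => z z1.
by rewrite -(subrKA (g z)) [leRHS]splitr (le_trans (ler_normD _ _))// lerD ?pg ?gf.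
Qed.

Lemma poly_approx_cst (c : C) : poly_approx (fun=> c).
Proof.
by apply: (poly_approx_ext _ (poly_approx_poly c%:P)) => z _; rewrite hornerC.
Qed.

Lemma poly_approx_sum n (F : nat -> C -> C) : (forall k, poly_approx (F k)) ->
  poly_approx (fun z => \sum_(k < n) F k z).
Proof.
move=> Fp; elim: n => [|n IH].
  by apply: (poly_approx_ext _ (poly_approx_cst 0)) => z _; rewrite big_ord0.
apply: (poly_approx_ext _ (poly_approxD IH (Fp n))) => z _.
by rewrite big_ord_recr.
Qed.

Lemma poly_approxX f n : poly_approx f -> poly_approx (fun z => f z ^+ n).
Proof.
move=> fp; elim: n => [|n IH].
  by apply: (poly_approx_ext _ (poly_approx_cst 1)) => z _.
by apply: (poly_approx_ext _ (poly_approxM fp IH)) => z _; rewrite exprS.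
Qed.

Lemma expr_eventually_le (r e : R) : 0 <= r < 1 -> 0 < e -> exists N, r ^+ N <= e.
Proof.
move=> /andP[r0 r1] e0.
have /cvgrPdist_le/(_ e e0)[N _ hN] := cvg_expr (z := r) (ltac:(by rewrite ger0_norm)).
by exists N; have := hN N (leqnn _); rewrite /= sub0r normrN ger0_norm ?exprn_ge0.
Qed.

(* With [L] large, [1 - g / L] is bounded away from [1] in modulus, so the
   Neumann series of [1 / g] converges uniformly. *)
Lemma poly_approxV g : poly_approx g ->
  (forall z, `|z| <= 1 -> 1 <= complex.Re (g z)) -> poly_approx (fun z => (g z)^-1).
Proof.
move=> gp g1; have [M' /gt0_realC[M M0 ->] gM] := poly_approx_bounded gp.
(* [|1 - g / L|^2 <= 1 - 2 / L + M^2 / L^2 <= 1 - 1 / L], because [Re g >= 1] and [M^2 <= L]; this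
   is the bound [r]. *)
pose L : R := 1 + M ^+ 2; have L0 : 0 < L by rewrite ltr_wpDr// sqr_ge0.
have L0' : L%:C != 0 :> C by rewrite -(rmorph0 (real_complex R)) (inj_eq (@complexI R)) gt_eqF.
pose u z := 1 - g z / L%:C.
have up : poly_approx u.
  have h := poly_approxM (poly_approx_cst (- L%:C^-1)) gp.
  apply: (poly_approx_ext _ (poly_approxD (poly_approx_cst 1) h)).
  by move=> z _; rewrite /u mulNr mulrC.
pose r := 1 - L^-1.
have r01 : 0 <= r < 1.
  by rewrite /r gtrBl invr_gt0 L0 andbT subr_ge0 invf_le1// /L lerDl sqr_ge0.
have ur z : `|z| <= 1 -> `|u z| ^+ 2 <= r%:C.
  move=> z1; have := gM z z1; rewrite -(ler_pXn2r (n := 2)) ?nnegrE//; last by rewrite ler0c ltW.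
  rewrite -add_Re2_Im2 -rmorphXn lecR => h; have h1 := g1 z z1.
  have -> : u z = (1 - complex.Re (g z) / L) -i* (complex.Im (g z) / L).
    rewrite /u -fmorphV; case: (g z) => a b /=; simpc.
    by congr (_ +i* _); ring.
  rewrite -add_Re2_Im2 lecR /= sqrrN /r.
  move: h h1; move: (complex.Re (g z)) (complex.Im (g z)) => a b h h1.
  pose s := L^-1; have s0 : 0 < s by rewrite invr_gt0.
  have : (a ^+ 2 + b ^+ 2) * s ^+ 2 <= s.
    rewrite expr2 mulrA ger_pMl// -ler_pdivlMr// div1r invrK /L.
    by rewrite (le_trans h)// lerDr.
  have : s <= a * s by rewrite ler_peMl// ltW.
  by rewrite -/s; lra.
have gn z : `|z| <= 1 -> 1 <= `|g z|.
  by move=> z1; apply: le_trans (Re_le_norm _); rewrite lecR g1.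
apply: poly_approx_lim => e /gt0_realC[e' e0 ->].
have [N rN] := expr_eventually_le r01 e0.
(* The number of terms is even because [r] bounds the square of [|u|]. *)
exists (fun z => L%:C^-1 * \sum_(k < N.*2) u z ^+ k).
  apply: poly_approxM; first exact: poly_approx_cst.
  by apply: (@poly_approx_sum _ (fun k z => u z ^+ k)) => k; exact: poly_approxX.
move=> z z1; have g0 : g z != 0 by rewrite -normr_gt0 (lt_le_trans ltr01)// gn.
have -> : L%:C^-1 * (\sum_(k < N.*2) u z ^+ k) - (g z)^-1 = - (u z ^+ N.*2 / g z).
  have := subrX1 (u z) N.*2; set S := \sum_(_ < _) _.
  have -> : u z - 1 = - (g z / L%:C) by rewrite /u addrC addKr.
  move/eqP; rewrite subr_eq => /eqP ->; field; exact/andP.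
rewrite normrN normrM normfV ler_pdivrMr ?normr_gt0//.
apply: (@le_trans _ _ (e'%:C)); last by rewrite ler_peMr ?ler0c ?(ltW e0)// gn.
rewrite -mul2n exprM normrX normrX (@le_trans _ _ (r%:C ^+ N))//.
  by rewrite lerXn2r ?nnegrE ?ur// ler0c; case/andP: r01.
by rewrite -rmorphXn lecR.
Qed.

Lemma cauchy_seq_complex (u : nat -> C) :
  (forall e : C, 0 < e -> exists N, forall n m, (N <= n)%N -> (N <= m)%N ->
     `|u n - u m| <= e) ->
  exists l, forall e : C, 0 < e -> exists N, forall n, (N <= n)%N -> `|l - u n| <= e.
Proof.
move=> uC.
have part (pr : C -> R) : (forall z w, pr (z - w) = pr z - pr w) ->
    (forall z, `|pr z|%:C <= `|z|) ->
    exists l : R, forall e, 0 < e -> exists N, forall n, (N <= n)%N -> `|l - pr (u n)| <= e.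
  move=> prB prn; apply: (@cauchy_seq_cvg _ R^o (pr \o u)) => e e0.
  have [|N hN] := uC e%:C; first by rewrite ltcR.
  exists N => n m Nn Nm; rewrite /= -prB -lecR (le_trans (prn _))//; exact: hN.
have [|z|a aP] := part (@complex.Re R); first by case=> ? ? [].
  exact: normc_ge_Re.
have [|z|b bP] := part (@complex.Im R); first by case=> ? ? [].
  have := normc_ge_Re (z * 'i%C); rewrite ReiNIm normrN normrM.
  by rewrite [`|'i%C|]normc_def /= expr0n expr1n add0r sqrtr1 mulr1.
exists (a +i* b) => e /gt0_realC[r r0 ->]; have r2 : 0 < r / 2 by rewrite divr_gt0.
have [N hN] := aP _ r2; have [M hM] := bP _ r2; exists (maxn N M) => n.
rewrite geq_max => /andP[/hN h1 /hM h2].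
have -> : a +i* b - u n = (a - complex.Re (u n))%:C + (b - complex.Im (u n))%:C * 'i%C.
  by case: (u n) => c d /=; simpc.
rewrite (le_trans (ler_normD _ _))// normrM !normc_def /= !expr0n/= !addr0 add0r expr1n.
rewrite sqrtr1 mulr1 -rmorphD lecR !sqrtr_sqr [leRHS]splitr; exact: lerD.
Qed.

Lemma Re_inv_ge0 (w : C) : 0 <= complex.Re w -> 0 <= complex.Re w^-1.
Proof. by case: w => a b /= a0; rewrite divr_ge0// addr_ge0 ?sqr_ge0. Qed.

Section Bump.
Variables (c : C) (l : R).
Hypotheses (c1 : `|c| = 1) (l0 : 0 < l).

(** A rational function whose pole [(1 + l) c] lies just outside the disk. [1 - z c^*] has
    nonnegative real part on the disk, so the function has too; it is of order 1 within [l] of [c]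
    and decays like [l / |z - c|]. *)
Definition bump (z : C) : C := (1 + (1 - z * c^*%R) / l%:C)^-1.

Let shift z : C := (1 - z * c^*%R) / l%:C.

Let norm_shift z : `|shift z| = `|z - c| / l%:C.
Proof.
rewrite /shift normrM normfV [X in _ / X]ger0_norm ?ler0c ?(ltW l0)//; congr (_ / _).
have cc : c * c^*%R = 1 by rewrite -normCK c1 expr1n.
have -> : 1 - z * c^*%R = (c - z) * c^*%R by rewrite mulrBl cc.
by rewrite normrM norm_conjC c1 mulr1 distrC.
Qed.

Let Re_shift z : `|z| <= 1 -> 0 <= complex.Re (shift z).
Proof.
move=> z1; have h : (complex.Re (z * c^*%R))%:C <= 1.
  by rewrite (le_trans (Re_le_norm _))// normrM norm_conjC c1 mulr1.
rewrite /shift -fmorphV; move: h; rewrite lecR.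
by case: (z * _) => a b /= a1; rewrite mulr0 subr0 mulr_ge0 ?subr_ge0 ?invr_ge0 ?(ltW l0).
Qed.

Lemma poly_approx_bump : poly_approx bump.
Proof.
apply: poly_approxV => [|z z1]; last first.
  by rewrite ReD /= lerDl Re_shift.
apply: (poly_approx_ext _ (poly_approx_poly (1 + (1 - c^*%R *: 'X) * (l%:C^-1)%:P))) => z _.
by rewrite !hornerE [z * _]mulrC.
Qed.

Lemma Re_bump_ge0 z : `|z| <= 1 -> 0 <= complex.Re (bump z).
Proof. by move=> z1; rewrite Re_inv_ge0// ReD addr_ge0 ?Re_shift. Qed.

Lemma Re_bump_near z : `|z| <= 1 -> `|z - c| <= l%:C -> 4^-1 <= complex.Re (bump z).
Proof.
move=> z1 zc; have := Re_shift z1; move=> a0.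
have ab : complex.Re (shift z) ^+ 2 + complex.Im (shift z) ^+ 2 <= 1.
  by rewrite -lecR add_Re2_Im2 expr_le1// norm_shift ler_pdivrMr ?mul1r// ltcR.
rewrite /bump -/(shift z); move: a0 ab; case: (shift z) => a b /= a0 ab; rewrite add0r.
(* The value 1/4 comes from [Re (1 + shift z) >= 1] and [|1 + shift z| <= 2]. *)
have D0 : 0 < (1 + a) ^+ 2 + b ^+ 2 by rewrite ltr_wpDr ?sqr_ge0// exprn_gt0// ltr_pwDl.
by rewrite ler_pdivlMr//; nra.
Qed.

Lemma norm_bump_far z (d : R) : `|z| <= 1 -> 0 < d -> d%:C <= `|z - c| ->
  `|bump z| <= (l / d)%:C.
Proof.
move=> z1 d0 dz; rewrite /bump -/(shift z) normfV.
have h : (d / l)%:C <= `|shift z|.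
  by rewrite norm_shift rmorphM fmorphV ler_pM2r ?invr_gt0 ?ltcR.
have h' : `|shift z| <= `|1 + shift z|.
  rewrite -(ler_pXn2r (n := 2)) ?nnegrE// -!add_Re2_Im2 lecR.
  have := Re_shift z1; case: (shift z) => a b /= a0; rewrite add0r lerD2r; nra.
have dl : 0 < (d / l)%:C :> C by rewrite ltcR divr_gt0.
have -> : (l / d)%:C = ((d / l)%:C)^-1 :> C by rewrite -fmorphV invf_div.
by rewrite lef_pV2 ?posrE ?(lt_le_trans dl)// ?(le_trans h).
Qed.

End Bump.

Variable E : set C.
Hypothesis E1 : forall z, E z -> `|z| = 1.
Hypothesis Ecl : forall z, ~ E z -> `|z| = 1 ->
  exists2 d : C, 0 < d & forall w, `|w| = 1 -> `|w - z| < d -> ~ E w.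
Hypothesis E0 : circle_null E.

(** A sum of bumps over a cover of total radius at most [e d / (4 M)], scaled by [4 M]. On [E] one
    bump has real part at least 1/4, which gives [M]; at distance [d] from [E] the bumps add up to
    at most [4 M (sum of l_k) / d <= e]. *)
Lemma large_on_null_set (M d e : R) : 0 < M -> 0 < d -> 0 < e ->
  exists2 h, poly_approx h &
    [/\ forall z, `|z| <= 1 -> 0 <= complex.Re (h z),
        forall z, E z -> M <= complex.Re (h z) &
        forall z, `|z| <= 1 -> (forall w, E w -> d%:C <= `|z - w|) ->
          `|h z| <= e%:C].
Proof.
move=> M0 d0 e0.
have [exE|noE] := pselect (exists z, E z); last first.
  exists (fun=> 0); first exact: poly_approx_cst.
  split=> [//|z Ez|z _ _]; first by exfalso; apply: noE; exists z.
  by rewrite normr0 ler0c ltW.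
have eta0 : 0 < e * d / (4 * M) by rewrite !(divr_gt0, mulr_gt0).
have [n [c [l [Ec l0 ls cov]]]] := null_circle_cover E1 Ecl E0 eta0 exE.
have c1 k : `|c k| = 1 by exact: E1.
have ReS z (m : nat) : complex.Re ((4 * M)%:C * \sum_(k < m) bump (c k) (l k) z) =
    4 * M * \sum_(k < m) complex.Re (bump (c k) (l k) z).
  elim: m => [|m IH]; first by rewrite !big_ord0 !mulr0.
  by rewrite !big_ord_recr/= !mulrDr ReD IH; congr (_ + _); case: (bump _ _ _) => a b /=; ring.
have b0 z (k : nat) : `|z| <= 1 -> 0 <= complex.Re (bump (c k) (l k) z).
  by move=> z1; apply: Re_bump_ge0.
have M4 : 0 <= 4 * M by rewrite mulr_ge0// ltW.
exists (fun z => (4 * M)%:C * \sum_(k < n) bump (c k) (l k) z).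
  apply: poly_approxM; first exact: poly_approx_cst.
  by apply: (@poly_approx_sum _ (fun k => bump (c k) (l k))) => k; exact: poly_approx_bump.
split=> [z z1|z Ez|z z1 zE].
- by rewrite ReS mulr_ge0// sumr_ge0// => k _; exact: b0.
- have z1 : `|z| <= 1 by rewrite E1.
  have [k kn zk] := cov z Ez; rewrite ReS (bigD1 (Ordinal kn))//=.
  have h := Re_bump_near (c1 k) (l0 k) z1 zk.
  have h' : 0 <= \sum_(i < n | i != Ordinal kn) complex.Re (bump (c i) (l i) z).
    by rewrite sumr_ge0// => i _; exact: b0.
  by rewrite (@le_trans _ _ (4 * M * 4^-1))//; [lra|rewrite ler_wpM2l//; lra].
- rewrite normrM [X in X * _]ger0_norm ?ler0c//.
  apply: (@le_trans _ _ ((4 * M)%:C * (\sum_(k < n) l k / d)%:C)).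
    rewrite ler_wpM2l ?ler0c// (le_trans (ler_norm_sum _ _ _))// rmorph_sum ler_sum// => k _.
    by rewrite norm_bump_far// zE.
  rewrite -rmorphM lecR -mulr_suml mulrA ler_pdivrMr// mulrC -ler_pdivlMr// mulr_gt0//.
Qed.

End PolynomialApproximation.

(** * Functions vanishing on a null set *)

Section Fatou.
Variable R : realType.
Local Notation C := R[i].
Variable E : set C.
Hypothesis E1 : forall z, E z -> `|z| = 1.
Hypothesis Ecl : forall z, ~ E z -> `|z| = 1 ->
  exists2 d : C, 0 < d & forall w, `|w| = 1 -> `|w - z| < d -> ~ E w.
Hypothesis E0 : circle_null E.

Lemma norm_inv1D_le (w : C) (t : R) : 0 < t -> t <= complex.Re w ->
  `|(1 + w)^-1| <= (t^-1)%:C.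
Proof.
move=> t0 tw; have h : t%:C <= `|1 + w|.
  by rewrite (le_trans _ (Re_le_norm _))// lecR ReD /= ler_wpDl.
have t0' : 0 < t%:C :> C by rewrite ltcR.
by rewrite normfV fmorphV lef_pV2// posrE (lt_le_trans t0').
Qed.

Lemma norm_inv1D_le1 (w : C) : 0 <= complex.Re w -> `|(1 + w)^-1| <= 1.
Proof.
move=> w0; have h : 1 <= `|1 + w|.
  by rewrite (le_trans _ (Re_le_norm _))// lecR ReD /= lerDl.
by rewrite normfV invf_le1// (lt_le_trans ltr01).
Qed.

Lemma one_add_neq0 (w : C) : 0 <= complex.Re w -> 1 + w != 0.
Proof.
move=> w0; apply/eqP => /(congr1 (@complex.Re R)); rewrite ReD /= => h.
by move: (ltr_pwDl ltr01 w0); rewrite h ltxx.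
Qed.

(** A point of the right half-plane is no farther from 0 than from -1. The bound on [|1 - f|] close
    to 1 originates here. *)
Lemma norm_1B_inv1D_le1 (w : C) : 0 <= complex.Re w -> `|1 - (1 + w)^-1| <= 1.
Proof.
move=> w0; have nw := one_add_neq0 w0.
have -> : 1 - (1 + w)^-1 = w / (1 + w) by field.
rewrite normrM normfV ler_pdivrMr ?normr_gt0// mul1r.
rewrite -(ler_pXn2r (n := 2)) ?nnegrE// -!add_Re2_Im2 lecR.
by move: w0; case: (w) => a b /= a0; rewrite add0r lerD2r; nra.
Qed.

Lemma norm_inv1D_sub (w v : C) : 0 <= complex.Re w -> 0 <= complex.Re v ->
  `|(1 + v)^-1 - (1 + w)^-1| <= `|v - w|.
Proof.
move=> w0 v0; have nw := one_add_neq0 w0; have nv := one_add_neq0 v0.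
have -> : (1 + v)^-1 - (1 + w)^-1 = (w - v) * (1 + v)^-1 * (1 + w)^-1.
  by field; exact/andP.
rewrite !normrM distrC -mulrA ler_piMr// mulr_ile1 ?normr_ge0 ?norm_inv1D_le1//.
Qed.

Variable e : R.
Hypothesis e0 : 0 < e.

(** Chosen so that [2 / t n = e / 2 ^+ n], a summable sequence. *)
Let t n := 2 * 2 ^+ n / e.

(** The factor 2 is a margin: near [E], where [h] varies by at most [t n], the real part is still at
    least [t n]. *)
Let good n (h : C -> C) := [/\ poly_approx h,
  forall z, `|z| <= 1 -> 0 <= complex.Re (h z) &
  forall z, E z -> 2 * t n <= complex.Re (h z)].

Let t_gt0 n : 0 < t n. Proof. by rewrite divr_gt0// mulr_gt0// exprn_gt0. Qed.

(** The radius [d] comes from the uniform continuity of [h], and the increment [g] is then made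
    small beyond distance [d] from [E]. Far from [E] the change is at most [|g|], since
    [1 / (1 + w)] is 1-Lipschitz on the right half-plane; within [d] of [E] both reciprocals are at
    most [1 / t n], however large [g] is. *)
Let step n h : good n h -> exists2 k, good n.+1 k &
  forall z, `|z| <= 1 -> `|(1 + k z)^-1 - (1 + h z)^-1| <= (e / 2 ^+ n)%:C.
Proof.
move=> [hp h0 hE].
have tC : 0 < (t n)%:C :> C by rewrite ltcR.
have [_ /gt0_realC[d d0 ->] hd] := poly_approx_unif_continuous hp tC.
have en : 0 < e / 2 ^+ n by rewrite divr_gt0// exprn_gt0.
have M0 : 0 < 2 * t n.+1 by rewrite mulr_gt0.
have [g gp [g0 gE gd]] := large_on_null_set E1 Ecl E0 M0 d0 en.
exists (fun z => h z + g z).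
  split=> [|z z1|z Ez]; first exact: poly_approxD.
    by rewrite ReD addr_ge0 ?h0 ?g0.
  by rewrite ReD ler_wpDl ?gE// h0// E1.
move=> z z1; have [far|] := pselect (forall w, E w -> d%:C <= `|z - w|).
  rewrite (le_trans (norm_inv1D_sub _ _))// ?ReD ?addr_ge0 ?h0 ?g0//.
  by rewrite addrC addKr gd.
move=> /existsNP[w /not_implyP[Ew /negP far]].
have zw : `|z - w| <= d%:C.
  have dr : d%:C \is @Num.real C by rewrite gtr0_real// ltcR.
  by have [//|/ltW] := real_leP (normr_real (z - w)) dr; rewrite (negbTE far).
have ht : t n <= complex.Re (h z).
  have w1 : `|w| <= 1 by rewrite E1.
  have := hd z w z1 w1 zw; rewrite distrC => hzw.
  have := le_trans (Re_le_norm _) hzw; have := hE w Ew.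
  by case: (h w) (h z) => a b [a' b'] /=; rewrite lecR; lra.
have -> : (e / 2 ^+ n)%:C = ((t n)^-1 + (t n)^-1)%:C.
  by congr (_%:C); rewrite /t; field; rewrite expf_neq0//= gt_eqF.
rewrite rmorphD (le_trans (ler_normB _ _))// lerD ?norm_inv1D_le//.
by rewrite ReD ler_wpDr ?g0.
Qed.

(** The origin is at distance 1 from the circle, so with [d = 1] it counts as far from [E]. *)
Let start : exists2 h, good 0%N h & `|h 0| <= e%:C.
Proof.
have M0 : 0 < 2 * t 0 by rewrite mulr_gt0.
have [h hp [h0 hE hd]] := large_on_null_set E1 Ecl E0 M0 ltr01 e0.
exists h => //; apply: hd => [|w Ew]; first by rewrite normr0.
by rewrite sub0r normrN E1.
Qed.

(* A weak form of Fatou's theorem on null sets of the circle: [f] is the limit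
   of the functions [1 / (1 + h_n)], where [h_n] has nonnegative real part and
   becomes large on [E]. *)
Lemma null_set_vanishing : exists f, [/\ poly_approx f,
  forall z, E z -> f z = 0,
  forall z, `|z| <= 1 -> `|1 - f z| <= (1 + 2 * e)%:C &
  `|1 - f 0| <= (3 * e)%:C].
Proof.
have [h0 good0 h00] := start.
pose S := {x : nat * (C -> C) | good x.1 x.2}.
have [u [u0 uS]] : exists u : nat -> S, u 0%N = exist _ (0%N, h0) good0 /\ forall n,
    (sval (u n.+1)).1 = (sval (u n)).1.+1 /\ forall z, `|z| <= 1 ->
    `|(1 + (sval (u n.+1)).2 z)^-1 - (1 + (sval (u n)).2 z)^-1| <= (e / 2 ^+ (sval (u n)).1)%:C.
  have st (x : S) : exists y : S, (sval y).1 = (sval x).1.+1 /\ forall z, `|z| <= 1 ->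
      `|(1 + (sval y).2 z)^-1 - (1 + (sval x).2 z)^-1| <= (e / 2 ^+ (sval x).1)%:C.
    case: x => -[n h] /= gh; have [k gk hk] := step gh.
    by exists (exist _ (n.+1, k) gk).
  have [F FP] := choice st.
  by exists (fun n => iter n F (exist _ (0%N, h0) good0)); split => // n; exact: FP.
have u1 n : (sval (u n)).1 = n by elim: n => [|n IH]; [rewrite u0|rewrite (uS n).1 IH].
pose h n := (sval (u n)).2; pose f n z := (1 + h n z)^-1.
have hg n : good n (h n) by have := svalP (u n); rewrite u1.
have fS n z : `|z| <= 1 -> `|f n.+1 z - f n z| <= (e / 2 ^+ n)%:C.
  by move=> z1; have := (uS n).2 z z1; rewrite u1.
have fp n : poly_approx (f n).
  have [hp hn _] := hg n; apply: poly_approxV; first exact: poly_approxD (poly_approx_cst 1) hp.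
  by move=> z z1; rewrite ReD lerDl hn.
have fD n k z : `|z| <= 1 -> `|f (n + k)%N z - f n z| <= (2 * e / 2 ^+ n)%:C.
  move=> z1; suff : `|f (n + k)%N z - f n z| <= (2 * e / 2 ^+ n - 2 * e / 2 ^+ (n + k))%:C.
    move/le_trans; apply; rewrite lecR gerBl divr_ge0 ?exprn_ge0// mulr_ge0//.
    exact: ltW.
  elim: k => [|k IH]; first by rewrite addn0 !subrr normr0.
  rewrite addnS -(subrKA (f (n + k)%N z)) (le_trans (ler_normD _ _))//.
  apply: le_trans (lerD (fS _ _ z1) IH) _; rewrite -rmorphD lecR.
  by rewrite le_eqVlt; apply/orP; left; apply/eqP; rewrite exprS; field; rewrite !expf_neq0.
have small (r : R) : 0 < r -> exists N, 2 * e / 2 ^+ N <= r.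
  move=> r0; have [||N hN] := @expr_eventually_le R 2^-1 (r / (2 * e)).
  - by rewrite invr_ge0 invf_lt1// ltr1n ler0n.
  - by rewrite divr_gt0// mulr_gt0.
  by exists N; rewrite -exprVn mulrC -ler_pdivlMr// mulr_gt0.
have small2 n N : (N <= n)%N -> 2 * e / 2 ^+ n <= 2 * e / 2 ^+ N.
  by move=> Nn; rewrite ler_pM2l ?mulr_gt0// lef_pV2 ?posrE ?exprn_gt0// ler_eXn2l// ltr1n.
have lim z : `|z| <= 1 -> exists l, forall d : C, 0 < d ->
    exists N, forall n, (N <= n)%N -> `|l - f n z| <= d.
  move=> z1; apply: cauchy_seq_complex => _ /gt0_realC[r r0 ->].
  have [|N hN] := small (r / 2); first by rewrite divr_gt0.
  have hn n : (N <= n)%N -> `|f n z - f N z| <= (r / 2)%:C.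
    by move=> /subnKC <-; rewrite (le_trans (fD _ _ _ z1))// lecR.
  exists N => n m Nn Nm; rewrite -(subrKA (f N z)) (le_trans (ler_normD _ _))//.
  by rewrite [r]splitr rmorphD lerD ?hn// distrC hn.
pose F z := if pselect (`|z| <= 1) is left z1 then projT1 (cid (lim z z1)) else 0.
have Ff n z : `|z| <= 1 -> `|F z - f n z| <= (2 * e / 2 ^+ n)%:C.
  move=> z1; rewrite /F; case: pselect => // z1'; case: cid => l lP /=.
  apply/ler_addgt0Pl => d d0; have [N hN] := lP d d0.
  rewrite -(subrKA (f (n + N)%N z)) (le_trans (ler_normD _ _))// lerD ?fD//.
  by rewrite hN// leq_addl.
have F0 z : `|z| <= 1 -> `|F z - f 0 z| <= (2 * e)%:C.
  by move=> z1; have := Ff 0 z z1; rewrite expr0 divr1.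
exists F; split.
- apply: poly_approx_lim => _ /gt0_realC[r r0 ->]; have [N hN] := small r r0.
  by exists (f N) => // z z1; rewrite distrC (le_trans (Ff _ _ z1))// lecR.
- move=> z Ez; have z1 : `|z| <= 1 by rewrite E1.
  apply/eqP; rewrite -normr_le0; apply/ler_addgt0Pl => _ /gt0_realC[r r0 ->]; rewrite addr0.
  have [|N hN] := small (r / 2); first by rewrite divr_gt0.
  rewrite -(subrK (f N z) (F z)) (le_trans (ler_normD _ _))// [r]splitr rmorphD lerD//.
    by rewrite (le_trans (Ff _ _ z1))// lecR.
  have [_ _ hE] := hg N.
  rewrite (@le_trans _ _ ((2 * t N)^-1)%:C)//.
    by apply: norm_inv1D_le; [rewrite mulr_gt0|exact: hE].
  rewrite lecR (le_trans _ hN)//.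
  have -> : (2 * t N)^-1 = (2 * e / 2 ^+ N) / 8.
    by rewrite /t; field; rewrite expf_neq0//= gt_eqF.
  by rewrite ler_pdivrMr// ler_peMr ?ler1n// divr_ge0 ?exprn_ge0// mulr_ge0// ltW.
- move=> z z1; have [_ hn _] := hg 0%N.
  rewrite -(subrKA (f 0 z)) (le_trans (ler_normD _ _))// rmorphD lerD//.
    exact: norm_1B_inv1D_le1 (hn z z1).
  by rewrite distrC F0.
(* Of [3 e], one [e] is [|1 - f 0 0| <= |h 0 0|], by comparison of [1 / (1 + w)] at [h 0 0] and at
   0; the other two bound the distance from [f 0] to the limit. *)
- rewrite -(subrKA (f 0 0)) (le_trans (ler_normD _ _))//.
  have -> : 3 * e = e + 2 * e by ring.
  rewrite rmorphD lerD//; last by rewrite distrC F0// normr0.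
  have [_ hn _] := hg 0%N; have hr : 0 <= complex.Re (h 0%N 0) by rewrite hn// normr0.
  have := @norm_inv1D_sub (h 0%N 0) 0 hr (lexx _).
  rewrite addr0 invr1 sub0r normrN => /le_trans; apply.
  by rewrite /h u0.
Qed.

End Fatou.

Section PolyOp.
Variables (R : realType) (H : completeNormedModType R[i]).
Local Notation C := R[i].
Variable T : {linear H -> H}.

Lemma poly_op_widen n (p : {poly C}) x : (size p <= n)%N ->
  poly_op T p x = \sum_(k < n) p`_k *: iter k T x.
Proof.
move=> pn; rewrite /poly_op (big_ord_widen n (fun k => p`_k *: iter k T x) pn).
rewrite big_mkcond /=; apply: eq_bigr => k _; case: ltnP => // pk.
by rewrite nth_default// scale0r.
Qed.

Lemma poly_opB (p q : {poly C}) x :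
  poly_op T (p - q) x = poly_op T p x - poly_op T q x.
Proof.
set n := maxn (size p) (size q).
rewrite (@poly_op_widen n (p - q)); last first.
  by rewrite (leq_trans (size_polyD _ _))// size_polyN.
rewrite (@poly_op_widen n p) ?leq_maxl// (@poly_op_widen n q) ?leq_maxr// -sumrB.
by apply: eq_bigr => k _; rewrite coefB scalerBl.
Qed.

Lemma poly_op_MXaddC (q : {poly C}) c x :
  poly_op T (q * 'X + c%:P) x = poly_op T q (T x) + c *: x.
Proof.
rewrite (@poly_op_widen (size q).+1); last first.
  rewrite (leq_trans (size_polyD _ _))// geq_max (leq_trans (size_polyC_leq1 _))// andbT.
  by have [->|q0] := eqVneq q 0; rewrite ?mul0r ?size_poly0// size_mulX.
rewrite big_ord_recl /= coefD coefMX coefC add0r addrC; congr (_ + _).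
by apply: eq_bigr => k _; rewrite coefD coefMX coefC addr0 -iterSr.
Qed.

Lemma poly_op_linear (p : {poly C}) a x y :
  poly_op T p (a *: x + y) = a *: poly_op T p x + poly_op T p y.
Proof.
rewrite /poly_op scaler_sumr -big_split; apply: eq_bigr => k _ /=.
by rewrite iter_linear scalerDr !scalerA mulrC.
Qed.

Lemma poly_op1 x : poly_op T 1 x = x.
Proof. by rewrite /poly_op size_poly1 big_ord1 coef1 scale1r. Qed.

End PolyOp.

(** * Uniform limits of polynomials belong to the disk algebra *)

Section DiskAlgebra.
Variables (R : realType) (H : completeNormedModType R[i]).
Local Notation C := R[i].
Variable dot : {dot H for @Num.conj C}.
Hypothesis dotE : hilbert_norm dot.

(* von Neumann's inequality for a scalar multiple of the identity. *)
Lemma max_modulus (x0 : H) (p : {poly C}) M : x0 != 0 ->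
  (forall w, `|w| = 1 -> `|p.[w]| <= M) -> forall z, `|z| <= 1 -> `|p.[z]| <= M.
Proof.
move=> nx0 pM z z1; pose T : {linear H -> H} := *:%R z.
have T1 : Defs.contraction T by move=> x; rewrite normrZ ler_piMl.
have := von_neumann dotE T1 x0 pM.
have -> : poly_op T p x0 = p.[z] *: x0.
  rewrite /poly_op horner_coef scaler_suml; apply: eq_bigr => k _.
  rewrite -scalerA; congr (_ *: _).
  by elim: (k : nat) => [|n IH]; rewrite ?expr0 ?scale1r// exprS -scalerA -IH.
by rewrite normrZ ler_pM2r ?normr_gt0.
Qed.

Variable x0 : H.
Hypothesis nx0 : x0 != 0.

(** On the circle [|w - a| >= 1 - |a|]; the maximum principle carries the bound inside. The bound
    depends on [p] only through [M], so it survives a limit of polynomials. *)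
Lemma difference_quotient_bound (p : {poly C}) (a M : C) : `|a| < 1 ->
  (forall z, `|z| <= 1 -> `|p.[z]| <= M) ->
  exists2 q : {poly C}, forall z, p.[z] = p.[a] + q.[z] * (z - a) &
    forall z, `|z| <= 1 -> `|q.[z]| <= 2 * M / (1 - `|a|).
Proof.
move=> a1 pM; have /factor_theorem[q pq] : root (p - p.[a]%:P) a.
  by rewrite rootE !hornerE subrr.
have qE z : p.[z] = p.[a] + q.[z] * (z - a).
  by move: pq => /(congr1 (horner^~ z)); rewrite !hornerE => <-; rewrite addrC subrK.
have b0 : 0 < 1 - `|a| by rewrite subr_gt0.
exists q => //; apply: (max_modulus nx0) => w w1.
rewrite ler_pdivlMr//; apply: (@le_trans _ _ `|q.[w] * (w - a)|).
  by rewrite normrM ler_wpM2l// -w1 lerB_dist.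
have -> : q.[w] * (w - a) = p.[w] - p.[a] by rewrite (qE w) addrAC subrr add0r.
by rewrite (le_trans (ler_normB _ _))// mulrDl mul1r lerD ?pM ?w1// ltW.
Qed.

(** The difference quotients [D h] are Cauchy as [h] tends to 0. For a polynomial with quotient [q]
    and second quotient [q2], [q(a + h) - q(a + k) = q2(a + h) h - q2(a + k) k], with a bound
    uniform over the approximants. *)
Lemma poly_approx_derivable (f : C^o -> C^o) a : poly_approx f ->
  `|a| < 1 -> derivable f a 1.
Proof.
move=> fp a1; have [B B0 fB] := poly_approx_bounded fp.
have b0 : 0 < 1 - `|a| by rewrite subr_gt0.
(* The quotient bound applied twice, starting from [B + 1], which bounds every approximant within 1
   of [f]. *)
pose K := 2 * (2 * (B + 1) / (1 - `|a|)) / (1 - `|a|).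
have K0 : 0 < K by rewrite divr_gt0// mulr_gt0// divr_gt0// mulr_gt0// addr_gt0.
pose D h : C := h^-1 * (f (a + h) - f a).
have DK h k : h != 0 -> k != 0 -> `|a + h| <= 1 -> `|a + k| <= 1 ->
    `|D h - D k| <= K * (`|h| + `|k|).
  move=> h0 k0 h1 k1; apply/ler_addgt0Pl => e e0.
  pose s := `|h|^-1 + `|k|^-1.
  have s0 : 0 < s by rewrite addr_gt0// invr_gt0 normr_gt0.
  have se0 : 0 < 2 * s + e by rewrite addr_gt0// mulr_gt0.
  (* The tolerance is at most 1, for the bound [B + 1], and keeps the error [2 n / |h| + 2 n / |k|]
     below [e]. *)
  pose n := e / (2 * s + e); have n0 : 0 < n by rewrite divr_gt0.
  have n1 : n <= 1 by rewrite ler_pdivrMr// mul1r lerDr mulr_ge0// ltW.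
  have ns : 2 * n * s <= e.
    have -> : 2 * n * s = e * (2 * s / (2 * s + e)) by rewrite /n; ring.
    by rewrite ler_piMr ?(ltW e0)// ler_pdivrMr// mul1r lerDl ltW.
  have [p pf] := fp n n0.
  have pB z : `|z| <= 1 -> `|p.[z]| <= B + 1.
    move=> z1; rewrite -(subrK (f z) p.[z]) addrC (le_trans (ler_normD _ _))// lerD ?fB//.
    exact: le_trans (pf z z1) n1.
  have [q pq qB] := difference_quotient_bound a1 pB.
  have [q2 qq2 q2B] := difference_quotient_bound a1 qB.
  have Dq l : l != 0 -> `|a + l| <= 1 -> `|D l - q.[a + l]| <= 2 * n / `|l|.
    move=> l0 l1; have -> : q.[a + l] = l^-1 * (p.[a + l] - p.[a]).
      by rewrite (pq (a + l)); field.
    rewrite /D -mulrBr normrM normfV mulrC ler_pM2r ?invr_gt0 ?normr_gt0//.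
    rewrite (_ : _ - _ - _ = - (p.[a + l] - f (a + l)) + (p.[a] - f a)); last by ring.
    rewrite (le_trans (ler_normD _ _))// normrN mulr2n mulrDl mul1r lerD ?pf// ltW//.
  have -> : D h - D k = (D h - q.[a + h]) + (q.[a + h] - q.[a + k]) - (D k - q.[a + k]) by ring.
  rewrite (le_trans (ler_normB _ _))//.
  apply: (@le_trans _ _ (2 * n / `|h| + K * (`|h| + `|k|) + 2 * n / `|k|)).
    rewrite lerD ?Dq// (le_trans (ler_normD _ _))// lerD ?Dq//.
    have -> : q.[a + h] - q.[a + k] = q2.[a + h] * h - q2.[a + k] * k.
      by rewrite (qq2 (a + h)) (qq2 (a + k)); ring.
    by rewrite (le_trans (ler_normB _ _))// mulrDr !normrM lerD// ler_wpM2r ?q2B.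
  by rewrite addrAC -mulrDr lerD2r.
pose hh n : C := (1 - `|a|) / 2 / n.+1%:R.
have hh0 n : 0 < hh n by rewrite !divr_gt0.
have hh1 n : `|a + hh n| <= 1.
  rewrite (le_trans (ler_normD _ _))// (gtr0_norm (hh0 n)) -lerBrDl.
  by rewrite /hh -mulrA ler_piMr ?(ltW b0)// -invfM invf_le1 ?mulr_gt0// -natrM ler1n.
have hhe (e : C) : 0 < e -> exists N, forall n, (N <= n)%N -> K * `|hh n| <= e.
  move=> e0; have Kb : 0 < K * ((1 - `|a|) / 2) by apply: mulr_gt0 => //; rewrite divr_gt0.
  have c0 : 0 < e / (K * ((1 - `|a|) / 2)) by rewrite divr_gt0.
  have [r r0 rE] := gt0_realC c0; have [N hN] := invS_eventually_le r0; exists N => n /hN h.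
  have : n.+1%:R^-1 <= e / (K * ((1 - `|a|) / 2)).
    by rewrite rE -(rmorph_nat (real_complex R)) -fmorphV lecR.
  rewrite ler_pdivlMr// => /(le_trans _); apply.
  by rewrite (gtr0_norm (hh0 n)) /hh [leRHS]mulrC -[leRHS]mulrA.
have [d dP] : exists l, forall e : C, 0 < e ->
    exists N, forall n, (N <= n)%N -> `|l - D (hh n)| <= e.
  apply: cauchy_seq_complex => e e0; have [|N hN] := hhe (e / 2); first by rewrite divr_gt0.
  exists N => n m Nn Nm; rewrite (le_trans (DK _ _ _ _ _ _)) ?gt_eqF//.
  by rewrite mulrDr [leRHS]splitr lerD ?hN.
have Dd h : h != 0 -> `|a + h| <= 1 -> `|d - D h| <= K * `|h|.
  move=> h0 h1; apply/ler_addgt0Pl => e e0.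
  have e2 : 0 < e / 2 by rewrite divr_gt0.
  have [N hN] := hhe _ e2; have [M hM] := dP _ e2; pose n := maxn N M.
  rewrite -(subrKA (D (hh n))) (le_trans (ler_normD _ _))//.
  apply: le_trans (lerD (hM n (leq_maxr _ _)) (DK _ _ _ h0 (hh1 n) h1)) _; first by rewrite gt_eqF.
  by rewrite mulrDr addrA lerD2r [leRHS]splitr lerD2l hN// leq_maxl.
apply/cvg_ex; exists d; apply/cvgrPdist_le => e e0; near=> h.
have h0 : h != 0 by near: h; exact: nbhs_dnbhs_neq.
have -> : h^-1 *: ((f \o shift a) (h *: 1) - f a) = D h.
  by rewrite /D /= [h *: 1]mulr1 [h + a]addrC.
have hb : `|h| <= 1 - `|a|.
  near: h; apply: dnbhs0_le => //.
rewrite (le_trans (Dd h h0 _))//.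
  by rewrite (le_trans (ler_normD _ _))// -lerBrDl.
rewrite mulrC -ler_pdivlMr//; near: h; apply: dnbhs0_le; exact: divr_gt0.
Unshelve. all: by end_near. Qed.

Lemma poly_approx_disk_algebra (f : C^o -> C^o) : poly_approx f -> disk_algebra f.
Proof.
move=> fp; split=> [z z1|]; first exact: poly_approx_derivable.
apply/subspace_continuousP => z z1; apply/cvgrPdist_le => e e0.
have [d d0 fd] := poly_approx_unif_continuous fp e0.
rewrite near_withinE; near=> w => w1; apply: fd => //.
near: w; apply: (@cvgr_dist_le _ _ _ (nbhs z) _ id z) => //.
Unshelve. all: by end_near. Qed.

End DiskAlgebra.

(** * The functional calculus and the compactness of the defect *)

Section Main.
Variables (R : realType) (H : completeNormedModType R[i]).
Local Notation C := R[i].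
Variable dot : {dot H for @Num.conj C}.
Hypothesis dotE : hilbert_norm dot.
Variable T : {linear H -> H}.
Hypothesis T1 : Defs.contraction T.

(** Von Neumann's inequality turns uniform closeness of the [p n] into operator-norm closeness of
    the [p n (T)], at an explicit rate. The last clause records that one polynomial approximates [f]
    and [F] simultaneously. *)
Lemma disk_calculus_exists (f : C -> C) : poly_approx f ->
  exists F, [/\ disk_calculus T f F, forall x y, F (x - y) = F x - F y &
    forall e : C, 0 < e -> exists p : {poly C},
      (forall z, `|z| <= 1 -> `|p.[z] - f z| <= e) /\
      (forall x, `|poly_op T p x - F x| <= e * `|x|)].
Proof.
move=> fp; have inv0 n : 0 < n.+1%:R^-1 :> C by rewrite invr_gt0 ltr0n.
have [p pf] := choice (fun n => fp _ (inv0 n)).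
have evinv (e : C) : 0 < e -> exists N, forall n, (N <= n)%N -> n.+1%:R^-1 <= e :> C.
  move=> /gt0_realC[r r0 ->]; have [N hN] := invS_eventually_le r0.
  by exists N => n /hN; rewrite -lecR fmorphV rmorph_nat.
have pp n m x : `|poly_op T (p n) x - poly_op T (p m) x| <= (n.+1%:R^-1 + m.+1%:R^-1) * `|x|.
  rewrite -poly_opB; apply: (von_neumann dotE T1) => w w1; rewrite !hornerE.
  have -> : (p n).[w] - (p m).[w] = ((p n).[w] - f w) - ((p m).[w] - f w) by ring.
  by rewrite (le_trans (ler_normB _ _))// lerD ?pf ?w1.
have lim x : exists l, forall e : C, 0 < e -> exists N, forall n, (N <= n)%N ->
    `|l - poly_op T (p n) x| <= e.
  apply: cauchy_seq_cvg => e e0; have x1 : 0 < `|x| + 1 by rewrite ltr_wpDl.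
  have [|N hN] := evinv (e / (2 * (`|x| + 1))); first by rewrite divr_gt0// mulr_gt0.
  exists N => n m Nn Nm; rewrite (le_trans (pp _ _ _))//.
  apply: (@le_trans _ _ ((e / (2 * (`|x| + 1)) + e / (2 * (`|x| + 1))) * (`|x| + 1))).
    by rewrite ler_pM ?addr_ge0 ?invr_ge0 ?ler0n// ?lerD ?hN// lerDl.
  by rewrite le_eqVlt; apply/orP; left; apply/eqP; field; exact: lt0r_neq0.
have [F FP] := choice lim.
have pF n x : `|poly_op T (p n) x - F x| <= n.+1%:R^-1 * `|x|.
  apply/ler_addgt0Pl => e e0; have x1 : 0 < `|x| + 1 by rewrite ltr_wpDl.
  have e2 : 0 < e / 2 by rewrite divr_gt0.
  have [|N hN] := evinv (e / 2 / (`|x| + 1)); first by rewrite divr_gt0.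
  have [M hM] := FP x _ e2; pose m := maxn N M.
  rewrite distrC -(subrKA (poly_op T (p m) x)) (le_trans (ler_normD _ _))//.
  rewrite [e]splitr -addrA lerD//; first by rewrite hM// leq_maxr.
  rewrite (le_trans (pp _ _ _))// mulrDl lerD2r.
  apply: (@le_trans _ _ (e / 2 / (`|x| + 1) * (`|x| + 1))); last by rewrite divfK// gt_eqF.
  by rewrite ler_pM ?invr_ge0 ?ler0n// ?hN ?leq_maxl// lerDl.
exists F; split.
- exists p; split=> e e0; have [N hN] := evinv e e0; exists N => // n /= Nn.
    by move=> z z1; rewrite (le_trans (pf n z z1))// hN.
  by move=> x; rewrite (le_trans (pF n x))// ler_wpM2r// hN.
- move=> x y; apply/eqP; rewrite -subr_eq0 -normr_le0; apply/ler_addgt0Pl => e e0; rewrite addr0.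
  pose s := `|x - y| + `|x| + `|y| + 1.
  have s0 : 0 < s by rewrite ltr_wpDl// !addr_ge0.
  have [|N hN] := evinv (e / s); first by rewrite divr_gt0.
  set P := poly_op T (p N); have PB : P (x - y) = P x - P y.
    by rewrite addrC -scaleN1r /P poly_op_linear scaleN1r addrC.
  rewrite -(subrKA (P x - P y)) (le_trans (ler_normD _ _))//.
  apply: (@le_trans _ _ (N.+1%:R^-1 * (`|x - y| + (`|x| + `|y|)))).
    rewrite mulrDr lerD//; first by rewrite distrC -PB pF.
    rewrite opprD addrACA -opprD (le_trans (ler_normB _ _))// mulrDr.
    by apply: lerD; exact: pF.
  apply: (@le_trans _ _ (e / s * s)); last by rewrite divfK// gt_eqF.
  by rewrite ler_pM ?invr_ge0 ?ler0n ?addr_ge0 ?hN// /s addrA lerDl.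
- move=> e e0; have [N hN] := evinv e e0; exists (p N); split=> [z z1|x].
    by rewrite (le_trans (pf N z z1))// hN.
  by rewrite (le_trans (pF N x))// ler_wpM2r// hN.
Qed.

(* If [1 - p = c + X q], then [1 - p(T) = c + q(T) T] and von Neumann's
   inequality bounds [q(T)]. *)
Lemma contraction_lower_bound (f : C -> C) F (p : {poly C}) (e : R) : 0 < e ->
  (forall z, `|z| <= 1 -> `|1 - f z| <= (1 + 2 * e)%:C) ->
  `|1 - f 0| <= (3 * e)%:C ->
  (forall z, `|z| <= 1 -> `|p.[z] - f z| <= e%:C) ->
  (forall x, `|poly_op T p x - F x| <= e%:C * `|x|) ->
  forall x, `|x| <= `|F x| + `|T x| + (12 * e)%:C * `|x|.
Proof.
move=> e0 f1 f0 pf pF x; pose r : {poly C} := 1 - p; pose c := r.[0].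
have [q rE] : exists q, r = q * 'X + c%:P.
  have /factor_theorem[q qE] : root (r - c%:P) 0.
    by rewrite rootE hornerD hornerN hornerC subrr.
  by exists q; move: qE; rewrite polyC0 subr0 => <-; rewrite subrK.
have c4 : `|c| <= (4 * e)%:C.
  have -> : c = (1 - f 0) - (p.[0] - f 0) by rewrite /c !hornerE; ring.
  have -> : 4 * e = 3 * e + e by ring.
  by rewrite (le_trans (ler_normB _ _))// rmorphD lerD// pf// normr0.
(* On the circle [|q| = |w q| = |1 - p - c|]; [7 e] collects [2 e] from [1 - f], [e] from [p - f]
   and [4 e] from [c]. *)
have qw w : `|w| = 1 -> `|q.[w]| <= (1 + 7 * e)%:C.
  move=> w1; have -> : `|q.[w]| = `|(1 - f w) - (p.[w] - f w) - c|.
    rewrite -[LHS]mulr1 -{1}w1 -normrM; congr `|_|.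
    have : r.[w] = q.[w] * w + c by rewrite rE !hornerE.
    by rewrite /r !hornerE => h; apply: (addIr c); rewrite -h; ring.
  have -> : 1 + 7 * e = (1 + 2 * e) + e + 4 * e by ring.
  rewrite (le_trans (ler_normB _ _))// [in leRHS]rmorphD lerD// (le_trans (ler_normB _ _))//.
  by rewrite rmorphD lerD ?f1 ?pf ?w1.
have xE : x = (poly_op T p x - F x) + F x + (poly_op T q (T x) + c *: x).
  by rewrite subrK -poly_op_MXaddC -rE /r poly_opB poly_op1 addrC subrK.
have qT := von_neumann dotE T1 (T x) qw.
apply: (@le_trans _ _ (e%:C * `|x| + `|F x| + ((1 + 7 * e)%:C * `|T x| + (4 * e)%:C * `|x|))).
  rewrite {1}xE (le_trans (ler_normD _ _))// lerD//.
    by rewrite (le_trans (ler_normD _ _))// lerD.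
  by rewrite (le_trans (ler_normD _ _))// lerD// normrZ ler_wpM2r.
(* Here [e] is the error of [p(T)] against [F], [7 e] the excess of [q(T)] over norm 1 (using
   [|T x| <= |x|]), and [4 e] the constant [c]. *)
have -> : (12 * e)%:C = e%:C + (7 * e)%:C + (4 * e)%:C.
  by rewrite -!rmorphD; congr (_%:C); ring.
have e7 : (7 * e)%:C * `|T x| <= (7 * e)%:C * `|x|.
  by rewrite ler_wpM2l ?T1// ler0c mulr_ge0// ltW.
rewrite -subr_ge0; rewrite -subr_ge0 in e7.
rewrite [X in 0 <= X](_ : _ = (7 * e)%:C * `|x| - (7 * e)%:C * `|T x|)//.
by rewrite [(1 + _)%:C]rmorphD rmorph1; ring.
Qed.

(** The lower bound is applied to differences [z = x - y] of unit-ball vectors: [|z|^2 - |T z|^2 =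
    (|z| - |T z|) (|z| + |T z|)], where the second factor is at most 4 and the first is controlled
    by [|F z| = |F x - F y|]. *)
Lemma defect_compact :
  (forall e : R, 0 < e -> exists F, [/\ compact_op F, forall x y, F (x - y) = F x - F y &
     forall x, `|x| <= `|F x| + `|T x| + e%:C * `|x|]) ->
  compact_op (fun x => x - adjoint dot T (T x)).
Proof.
move=> h; apply: compact_op_approx => e0 /gt0_realC[e e1 ->].
(* With [|z| <= 2] and [|F z| < e^2 / 16] the product is below
   [4 (e^2 / 16 + 2 e^2 / 32) = e^2 / 2]. *)
have e2 : 0 < e ^+ 2 / 32 by rewrite divr_gt0// exprn_gt0.
have [F [cF FB Fx]] := h _ e2.
exists F, (e ^+ 2 / 16)%:C; first by rewrite ltcR divr_gt0// exprn_gt0.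
split=> // x y x1 y1 Fxy; pose z := x - y.
have -> : x - adjoint dot T (T x) - (y - adjoint dot T (T y)) = z - adjoint dot T (T z).
  by rewrite /z (linearB T) adjoint_sub// opprD addrACA -opprD.
have z2 : `|z| <= 2 by rewrite (le_trans (ler_normB _ _))// (_ : 2 = 1 + 1)// lerD.
rewrite -(ltr_pXn2r (n := 2)) ?nnegrE// ?ler0c ?(ltW e1)//.
rewrite (le_lt_trans (defect_norm dotE T1 z))// subr_sqr.
have TzS : `|z| - `|T z| <= `|F z| + (e ^+ 2 / 32)%:C * 2.
  rewrite lerBlDl (le_trans (Fx z))// addrA (addrC `|T z|) lerD2l ler_wpM2l// ler0c ltW//.
apply: (@le_lt_trans _ _ ((`|F z| + (e ^+ 2 / 32)%:C * 2) * 4)).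
  have d0 : 0 <= `|z| - `|T z| by rewrite subr_ge0; exact: T1.
  have d4 : `|z| + `|T z| <= 4.
    by rewrite (_ : 4 = 2 + 2) ?lerD// ?(le_trans (T1 z))//; ring.
  by apply: ler_pM => //; exact: addr_ge0.
have : `|F z| < (e ^+ 2 / 16)%:C by rewrite /z FB.
move=> lt1; apply: (@lt_trans _ _ (((e ^+ 2 / 16)%:C + (e ^+ 2 / 32)%:C * 2) * 4)).
  by rewrite ltr_pM2r// ltrD2r.
have -> : ((e ^+ 2 / 16)%:C + (e ^+ 2 / 32)%:C * 2) * 4 = (e ^+ 2 / 2)%:C.
  rewrite -(rmorph_nat (real_complex R) 2) -(rmorph_nat (real_complex R) 4).
  by rewrite -rmorphM -rmorphD -rmorphM; congr (_%:C); field.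
by rewrite -rmorphXn ltcR ltr_pdivrMr// ltr_pMr ?ltr1n// exprn_gt0.
Qed.

End Main.

Theorem proposition2p5 (R : realType) (H : completeNormedModType R[i])
    (dot : {dot H for @Num.conj R[i]}) (T : {linear H -> H}) :
  hilbert_norm dot ->
  separable_space H ->
  C0_contraction dot T ->
  essentially_normal dot T ->
  circle_null (spectrum T `&` @unit_circle R) ->
  (forall f : R[i]^o -> R[i]^o,
     disk_algebra f ->
     (forall z, (spectrum T `&` @unit_circle R) z -> f z = 0) ->
     forall F : H -> H, disk_calculus T f F -> compact_op F) ->
  essentially_unitary dot T.
Proof.
move=> dotE _ [T1 _ _] _ E0 hcompact; split => //.
(* A nonzero vector is what lets operators on [H] see scalars in the maximum principle; the zero
   space is settled directly. *)
have [[x0 nx0]|triv] := pselect (exists x : H, x != 0); last first.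
  have H0 (x : H) : x = 0.
    by apply/eqP; apply: contraT => x0; exfalso; apply: triv; exists x.
  apply: totally_bounded_precompact => e e0; exists [:: 0] => _ [x _ <-].
  by exists 0; rewrite ?inE// [X in _ - X]H0 subrr normr0.
apply: (defect_compact dotE T1) => e e0.
have e12 : 0 < e / 12 by rewrite divr_gt0.
have E1 z : (spectrum T `&` @unit_circle R) z -> `|z| = 1 by case.
have Ecl z : ~ (spectrum T `&` @unit_circle R) z -> `|z| = 1 -> exists2 d : R[i], 0 < d &
    forall w, `|w| = 1 -> `|w - z| < d -> ~ (spectrum T `&` @unit_circle R) w.
  move=> nEz z1; have [|d d0 dP] := @resolvent_open _ _ T z; first by move=> Tz; exact: nEz.
  by exists d => // w _ wz [Tw _]; exact: dP wz Tw.
have [f [fp fE f1 f0]] := null_set_vanishing E1 Ecl E0 e12.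
have [F [fF FB approx]] := disk_calculus_exists dotE T1 fp.
have e12' : 0 < (e / 12)%:C :> R[i] by rewrite ltcR.
have [p [pf pF]] := approx _ e12'.
exists F; split => //.
  by apply: (hcompact f) => //; exact: (poly_approx_disk_algebra dotE nx0).
move=> x; have := contraction_lower_bound dotE T1 e12 f1 f0 pf pF x.
by have -> : 12 * (e / 12) = e by field.
Qed.
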